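(* Let $q$ be a power of a prime $p\neq3$. The unique conjugacy class of elements of order three of $\mathrm{PSL}(2,q)$, considered as a rack, is (1) abelian if $q=2$, and (2) minimal non-abelian if and only if $q=2^m$ for some odd prime $m$. Moreover, if $q=2^m$ for some odd prime $m$, then all proper non-trivial subracks (that is, proper subracks with more than one element) of this class have size two.
   Context: A rack is a non-empty set $X$ with a binary operation $\triangleright$ such that every map $y\mapsto x\triangleright y$ is bijective and $x\triangleright(y\triangleright z)=(x\triangleright y)\triangleright(x\triangleright z)$. Conjugacy classes of a group are racks via $g\triangleright h=ghg^{-1}$. A subrack is a non-empty subset closed under $\triangleright$. A rack is abelian if $x\triangleright y=y$ for all $x,y$; it is minimal non-abelian if it is not abelian but all of its proper subracks are abelian. For $p\ne3$, $\mathrm{PSL}(2,q)$ has exactly one conjugacy class of elements of order three. *)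

(* Defs.v *)
From HB Require Import structures.
From mathcomp Require Import all_boot all_algebra all_fingroup all_solvable.

Set Implicit Arguments.
Unset Strict Implicit.
Unset Printing Implicit Defensive.

Import GRing.Theory.
Local Open Scope group_scope.

(* Racks are finite and live on a subset X of an ambient finite type; the     *)
(* operation is total on the ambient type but only constrained on X. The      *)
(* equality in rack_bij also says that X is closed under the operation.       *)
Record is_rack (T : finType) (op : T -> T -> T) (X : {set T}) : Prop := IsRack {
  rack_neq0 : X != set0;
  rack_bij : {in X, forall x, {in X &, injective (op x)} /\ op x @: X = X};
  rack_dist : {in X & &, forall x y z, op x (op y z) = op (op x y) (op x z)}
}.

Record rack (T : finType) := Rack {
  rack_set :> {set T};
  rack_op : T -> T -> T;
  rackP : is_rack rack_op rack_set
}.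

Definition subrack (T : finType) (X : rack T) (Y : {set T}) : Prop :=
  [/\ Y \subset X, Y != set0 & {in Y &, forall x y, rack_op X x y \in Y}].

(* Stated for an operation and a set, so that it applies to a rack and to its *)
(* subracks alike.                                                            *)
Definition abelian_rack (T : finType) (op : T -> T -> T) (X : {set T}) : Prop :=
  {in X &, forall x y, op x y = y}.

Definition minimal_nonabelian (T : finType) (X : rack T) : Prop :=
  ~ abelian_rack (rack_op X) X
  /\ forall Y : {set T}, subrack X Y -> Y \proper X ->
       abelian_rack (rack_op X) Y.

Definition conj_op (gT : finGroupType) (g h : gT) : gT := g * h * g^-1.

Lemma class_is_rack (gT : finGroupType) (G : {group gT}) (x : gT) :
  x \in G -> is_rack (@conj_op gT) (x ^: G).
Proof.
move=> Gx; have cE (g h : gT) : conj_op g h = h ^ g^-1.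
  by rewrite /conj_op /conjg invgK mulgA.
have sCG y : y \in x ^: G -> y \in G.
  by case/imsetP=> g Gg ->; rewrite groupJ.
split; first by apply/set0Pn; exists x; exact: class_refl.
- move=> y Cy; split=> [z t _ _|]; first by rewrite !cE; apply: conjg_inj.
  have inj : injective (conj_op y) by move=> z t; rewrite !cE; apply: conjg_inj.
  apply/eqP; rewrite eqEcard (card_imset _ inj) leqnn andbT.
  apply/subsetP=> _ /imsetP[z /imsetP[g Gg ->] ->].
  by rewrite cE -conjgM; apply: imset_f; rewrite groupM // groupV sCG.
- by move=> y z t _ _ _; rewrite /conj_op !invMg !invgK !mulgA !mulgKV.
Qed.

Definition class_rack (gT : finGroupType) (G : {group gT}) (x : gT)
  (Gx : x \in G) : rack gT := Rack (class_is_rack Gx).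

(* Meaningful for 0 < n only: {'GL_0[F]} consists of 1 x 1 matrices.          *)
Definition SL (n : nat) (F : finFieldType) : {set {'GL_n[F]}} :=
  [set u : {'GL_n[F]} | (\det (GLval u) == 1)%R].

Lemma SL_group_set (n : nat) (F : finFieldType) : group_set (SL n F).
Proof.
apply/group_setP; split=> [|u v]; rewrite !inE; first by rewrite GL_1E det1.
by move=> /eqP du /eqP dv; rewrite GL_ME det_mulmx du dv mulr1.
Qed.

Canonical SL_group (n : nat) (F : finFieldType) := Group (SL_group_set n F).

Definition PSL (n : nat) (F : finFieldType) :=
  (SL_group n F / 'Z(SL_group n F))%G.

(* Main.v *)
Require Import Defs.
From mathcomp Require Import all_boot all_algebra all_fingroup all_solvable.
From mathcomp Require Import all_field.
From mathcomp Require Import ring.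

(** Elements of order 3 of PSL(2, F) are the images of the matrices of SL(2, F)
    with trace -1, whose characteristic polynomial is X^2 + X + 1. Each of these
    is conjugate to the companion matrix, in SL(2, F) and not only in GL(2, F):
    one needs a row vector [v] such that the rows [v] and [v u] have determinant
    exactly 1, and the binary quadratic form to be solved has discriminant -3,
    which is not zero since p is not 3. Hence the class is the set of all
    elements of order 3 ([class_order3]).

    Minimality fails in three situations. If an element [x] of order 3
    normalizes without centralizing an abelian group [V] of order prime to 3,
    the orbit of [x] under [V] is a proper non-abelian subrack
    ([normalized_abelian_not_minimal]); this applies to the image of a quaternion
    group when p is odd, and to the upper unipotent matrices when the field
    contains a primitive cube root of unity, which for q = 2^k happens when k is
    even. If k is odd and composite, the elements of order 3 with entries in an
    intermediate field form such a subrack. Finally for q = 2 the class consists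
    of two mutually inverse elements.

    Suppose now that q = 2^m with m an odd prime. A subrack is normalized by the
    group it generates, so everything follows from the fact that two
    non-commuting elements [x], [y] of order 3 generate a subgroup [H] equal to
    SL(2, F) ([noncommuting_order3_generate]). This is proved without the
    classification of the subgroups of PSL(2, q). In characteristic 2 the
    centralizer of any nontrivial element is commutative, and commuting elements
    with the same nonzero trace are equal or inverse to each other. Therefore an
    element of odd order that normalizes an r-subgroup of odd order centralizes
    it, and Burnside's normal complement theorem, applied to all primes r, shows
    that subgroups of odd order are abelian. Applied to a Sylow 2-subgroup [S] of
    [H], Burnside's theorem then provides an element [h] of [H] that normalizes
    but does not centralize [S]: otherwise [x] and [y] would lie in a normal
    2-complement, of odd order, and commute. In suitable coordinates [S] consists
    of upper unipotent matrices and [h] multiplies their parameters by a scalar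
    different from 0 and 1, which generates F because m is prime; so [S] contains
    all upper unipotent matrices. As [x] fixes no line, F having no primitive
    cube root of unity, a conjugate by [x] gives a second such group, and the two
    generate SL(2, F).

    Two elements of a proper subrack thus commute and, having the same trace, are
    equal or inverse to each other, which also gives the statement on sizes. *)

Set Implicit Arguments.
Unset Strict Implicit.
Unset Printing Implicit Defensive.

Import GRing.Theory.
Local Open Scope group_scope.

(** * Burnside's normal complement theorem *)

Section Burnside.

Variables (gT : finGroupType) (p : nat) (G S : {group gT}).
Hypotheses (sylS : p.-Sylow(G) S) (cNS : 'N_G(S) \subset 'C(S)).

Let sSG : S \subset G. Proof. exact: pHall_sub sylS. Qed.

Let abS : abelian S.
Proof. by apply: subset_trans cNS; rewrite subsetI sSG normG. Qed.

(** Both [S] and [S :^ g] are Sylow subgroups of the centralizer of [x ^ g], so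
    they are conjugate there: the element conjugating [x] may be taken in the
    normalizer of [S], which centralizes [x]. *)
Lemma abelian_Sylow_fusion x g :
  x \in S -> g \in G -> x ^ g \in S -> x ^ g = x.
Proof.
move=> Sx Gg Sxg.
have cS : S \subset 'C_G[x ^ g].
  by rewrite subsetI sSG sub_cent1 (subsetP abS).
have cSg : S :^ g \subset 'C_G[x ^ g].
  rewrite subsetI conj_subG //=.
  by rewrite cent1J conjSg sub_cent1 (subsetP abS).
have sylS' := pHall_subl cS (subsetIl _ _) sylS.
have [|h /setIP[Gh cxh] /= eqS] :=
    @Sylow_trans p _ ('C_G[x ^ g])%G S (S :^ g)%G sylS'.
  apply: (pHall_subl cSg (subsetIl _ _)).
  by rewrite /= -(conjGid Gg) pHallJ2.
have Ngh : g * h^-1 \in 'N_G(S).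
  by rewrite inE groupM ?groupV //= inE conjsgM eqS conjsgK.
have <- : x ^ (g * h^-1) = x ^ g.
  rewrite conjgM; apply/conjg_fixP/commgP/commuteV/esym.
  by move/cent1P: cxh.
by apply/conjg_fixP/commgP/commute_sym/(centP (subsetP cNS _ Ngh)).
Qed.

(** Burnside's normal complement theorem. The subgroup is the kernel of the
    transfer of [G] into the abelian group [S]: by the fusion lemma the transfer
    restricts on [S] to the power map of exponent [#|G : S|], which is injective
    because that index is prime to [p]. *)
Theorem Burnside_transfer :
  exists K : {group gT},
    [/\ K <| G, p^'.-group K, p.-group (G / K) & abelian (G / K)].
Proof.
have abA : abelian (idm S @* S) by rewrite morphim_idm.
pose V := transfer_morphism G abA.
have VS x : x \in S -> x \in 'ker V -> x = 1.
  move=> Sx /mker/=.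
  have Gx := subsetP sSG x Sx.
  have := rcosets_cycle_partition sSG Gx => part.
  pose X := transversal (rcosets S G :* <[x]>) G.
  have trX := transversalP part.
  rewrite (transfer_cycle_expansion sSG abA Gx trX).
  have sXG : {subset X <= G} by apply/subsetP/(transversal_sub trX).
  rewrite (eq_bigr (fun y => FiniteModule.fmod abA x *+ #|<[x]> : S :* y|)%R)
    => [|y Xy].
    rewrite GRing.sumrMnr (sum_index_rcosets_cycle sSG Gx trX).
    move/(congr1 val); rewrite FiniteModule.fmvalZ.
    rewrite FiniteModule.fmodK; last by rewrite /= morphim_idm.
    move=> xn1; have {}xn1 : x ^+ #|G : S| = 1 by [].
    have cop : coprime #|S| #|G : S|.
      by case/and3P: sylS => _ pS p'GS; apply: pnat_coprime pS p'GS.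
    by rewrite -(expgK cop Sx) xn1 expg1n.
  (* Each factor of the transfer lies in S and is conjugate to a power of x. *)
  set n := #|_ : _|.
  have Sxy : x ^+ n ^ y^-1 \in S.
    have := mulg_exp_card_rcosets S x y.
    by rewrite mem_rcoset conjgE invgK mulgA.
  rewrite (abelian_Sylow_fusion (groupX n Sx) _ Sxy) ?groupV ?sXG //.
  by rewrite /= /restrm /= FiniteModule.fmodX //= morphim_idm.
have nKG : G \subset 'N('ker V) by apply: ker_norm.
have isoV := first_isog V.
have fmvalI : 'injm (FiniteModule.fmval_morphism abA).
  by apply/injmP=> u v _ _; apply: FiniteModule.fmod_inj.
exists ('ker V)%G; split.
- exact: ker_normal.
- have := Sylow_setI_normal (ker_normal V) sylS.
  rewrite setIC (_ : S :&: _ = 1) => [/card_Hall|].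
    by rewrite cards1 => e; rewrite /pgroup -partn_eq1 ?cardG_gt0 // -e.
  by apply/trivgP/subsetP=> z /setIP[Sz Kz]; rewrite inE (VS z).
- rewrite (isog_pgroup p isoV) -(injm_pgroup fmvalI) ?subsetT //.
  apply: pgroupS (pHall_pgroup sylS).
  apply/subsetP=> _ /morphimP[u _ _ ->].
  by have := FiniteModule.fmodP u; rewrite /= morphim_idm.
by rewrite (isog_abelian isoV); apply/centsP=> u _ v _; apply: GRing.addrC.
Qed.

End Burnside.

(** * Subracks of conjugacy classes *)

Lemma conj_opE (gT : finGroupType) (g h : gT) : conj_op g h = h ^ g^-1.
Proof. by rewrite /conj_op /conjg invgK mulgA. Qed.

Lemma conj_op_eq (gT : finGroupType) (g h : gT) :
  (conj_op g h = h) <-> commute g h.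
Proof.
rewrite /conj_op /commute; split=> e; last by rewrite e mulgK.
by rewrite -{2}e mulgKV.
Qed.

Lemma class_rack_minimal_eq (rT : finGroupType) (H : {group rT}) (x y : rT)
    (Hx : x \in H) (Hy : y \in H) : x ^: H = y ^: H ->
  minimal_nonabelian (class_rack Hx) -> minimal_nonabelian (class_rack Hy).
Proof.
move=> e [nab min]; split; first by rewrite /= -e.
by move=> Y sY pY; apply: min; move: sY pY; rewrite /subrack /= e.
Qed.

Lemma subrack_setI (rT : finGroupType) (H L : {group rT}) (x y : rT)
    (Hx : x \in H) : y \in x ^: H -> y \in L ->
  subrack (class_rack Hx) (x ^: H :&: L).
Proof.
move=> Cy Ly; split; first exact: subsetIl.
  by apply/set0Pn; exists y; rewrite inE Cy.
move=> a b /setIP[Ca La] /setIP[Cb Lb]; rewrite /= conj_opE inE.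
have sCH z : z \in x ^: H -> z \in H by case/imsetP=> g Hg ->; rewrite groupJ.
by rewrite groupJ ?groupV // andbT -(class_eqP Cb) memJ_class ?groupV // sCH.
Qed.

(** The witness is the orbit of [x] under [V]. It lies in the coset [x V], which
    meets the powers of [x] in [x] only, so that it misses the inverse of [x]; it
    is closed because [V] and [x] generate a group in which [V] is normal. It is
    not abelian: if [x] commuted with its conjugate [x w], the element [w] of [V]
    would have trivial cube, hence be trivial. *)
Lemma normalized_abelian_not_minimal (gT : finGroupType) (G V : {group gT})
    (x : gT) (Gx : x \in G) :
  V \subset G -> abelian V -> x \in 'N(V) -> x \notin 'C(V) -> #[x] = 3 ->
  ~~ (3 %| #|V|) -> x^-1 \in x ^: G -> ~ minimal_nonabelian (class_rack Gx).
Proof.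
move=> sVG abV nVx ncVx ox n3V CxV [_ min].
have x3 : x ^+ 3 = 1 by rewrite -ox expg_order.
have nVx' : x^-1 \in 'N(V) by rewrite groupV.
have xJ a : x ^ a = x * (a^-1 ^ x * a) by rewrite !conjgE !mulgA mulgV mul1g.
have wV a : a \in V -> a^-1 ^ x * a \in V.
  by move=> Va; rewrite groupM // memJ_norm ?groupV.
have subY : subrack (class_rack Gx) (x ^: V).
  split; first exact: imsetS.
    by apply/set0Pn; exists x; apply: class_refl.
  move=> _ _ /imsetP[a Va ->] /imsetP[b Vb ->]; rewrite /= conj_opE -conjgM.
  (* Up to x^-1, which centralizes x, the conjugating element is in V. *)
  have -> : b * (x ^ a)^-1 = x^-1 * (b ^ x^-1 * (a^-1 ^ x^-1 * a)).
    by rewrite !conjgE !invMg !invgK !mulgA mulVg mul1g mulgKV.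
  rewrite conjgM (_ : x ^ x^-1 = x); last by rewrite conjgE invgK mulgV mulg1.
  apply: imset_f; apply: groupM; first by rewrite memJ_norm.
  by apply: groupM => //; rewrite memJ_norm ?groupV.
have prY : x ^: V \proper x ^: G.
  apply/properP; split; first exact: imsetS.
  exists x^-1 => //; apply/imsetP=> -[a Va]; rewrite xJ => e.
  (* Otherwise x^-1 = x w with w in V, so that x = x^-2 = w is in V. *)
  have /(congr1 (mulg x^-1)) := e; rewrite mulKg => ew.
  have ex : x = x^-1 * x^-1.
    apply: (mulgI x); apply: (mulgI x); rewrite mulKVg mulgV.
    by rewrite -[RHS]x3 !expgS expg0 mulg1.
  case/negP: ncVx; apply: (subsetP abV).
  by rewrite ex ew; apply: wV.
have /= abY := min _ subY prY.
case/negP: ncVx; apply/centP=> v Vv; set w := v^-1 ^ x * v.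
have Vw : w \in V by apply: wV.
have /conj_op_eq : conj_op x (x ^ v) = x ^ v.
  by apply: abY; rewrite ?class_refl ?imset_f.
rewrite xJ -/w => cxw.
have {cxw} cxw : commute x w.
  by rewrite -(mulKg x w); apply: commuteM => //; apply: commuteV.
have : (x ^ v) ^+ 3 = 1 by rewrite -conjXg x3 conj1g.
rewrite xJ -/w expgMn // x3 mul1g => w3.
have w1 : w = 1.
  apply/eqP; rewrite -order_eq1; apply: contraR n3V => ow.
  have: #[w] %| 3 by rewrite order_dvdn w3.
  case/((elimT primeP (isT : prime 3)).2 _)/orP => [|/eqP <-].
    by rewrite (negPf ow).
  exact: order_dvdG.
by apply/commgP/conjg_fixP; rewrite xJ -/w w1 mulg1.
Qed.

(** * Finite fields *)

Section FiniteFields.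

Variable F : finFieldType.
Local Open Scope ring_scope.

(** A certificate for deducing an equation from another one: [k] is the factor by
    which the hypothesis has to be multiplied, and what remains is an identity
    for [ring] or [field]. *)
Lemma lincomb (k x y l r : F) : l = r -> x - y = k * (l - r) -> x = y.
Proof. by move=> -> /eqP; rewrite subrr mulr0 subr_eq0 => /eqP. Qed.

Lemma sqrt_char2 (a : F) : (2 \in [pchar F])%N -> exists s, s ^+ 2 = a.
Proof.
move=> ch2; have inj : injective (pFrobenius_aut ch2) by apply: fmorph_inj.
by have [g _ gK] := injF_bij inj; exists (g a); rewrite -pFrobenius_autE gK.
Qed.

Lemma odd_card_finField : (2%:R : F) != 0 -> odd #|F|.
Proof.
have [p pr_p chF] := finPcharP F => nz2.
rewrite (card_pprimeChar chF) oddX; apply/orP; right.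
case: (even_prime pr_p) => // p2.
by move: chF nz2; rewrite p2 inE => /andP[_ ->].
Qed.

(** With [r] a choice of square roots, any [u] is [r (u ^+ 2)] or its opposite. *)
Lemma card_squares : (#|F| <= 2 * #|[set u ^+ 2 | u : F]|)%N.
Proof.
set A := [set _ | u : F].
pose r (a : F) := odflt 0 [pick u : F | u ^+ 2 == a].
rewrite mul2n -addnn -cardsT.
have leU := leq_card_setU (r @: A) [set - r a | a in A].
apply: leq_trans (subset_leq_card _) (leq_trans leU _).
  apply/subsetP=> u _.
  have : r (u ^+ 2) ^+ 2 == u ^+ 2.
    by rewrite /r; case: pickP => [v //|/(_ u)]; rewrite eqxx.
  have Au : u ^+ 2 \in A by apply: imset_f.
  rewrite eqf_sqr => /orP[]/eqP e; apply/setUP; [left | right].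
    by apply/imsetP; exists (u ^+ 2).
  by apply/imsetP; exists (u ^+ 2); rewrite ?e ?opprK.
by rewrite leq_add // leq_imset_card.
Qed.

(** Both sides of [alpha * u ^+ 2 = gamma - beta * t ^+ 2] take more than half
    of the values of the field, hence a common one. *)
Lemma two_squares (alpha beta gamma : F) :
  odd #|F| -> alpha != 0 -> beta != 0 ->
  exists u t, alpha * u ^+ 2 + beta * t ^+ 2 = gamma.
Proof.
move=> oddF nza nzb; set A := [set u ^+ 2 | u : F].
pose B1 := [set alpha * a | a in A]; pose B2 := [set gamma - beta * a | a in A].
have [|/set0Pn[z /setIP[/imsetP[_ /imsetP[u _ ->] ->]]]] :=
  eqVneq (B1 :&: B2) set0.
  move=> e; have := cardsUI B1 B2; rewrite e cards0 addn0.
  have injB2 : injective (fun a => gamma - beta * a).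
    by move=> x y /addrI/oppr_inj/(mulfI nzb).
  rewrite (card_imset _ (mulfI nza)) (card_imset _ injB2).
  rewrite addnn -mul2n => le; have := max_card (B1 :|: B2); rewrite le.
  have := card_squares; rewrite -/A => le1 le2.
  have e2 : #|F| = (2 * #|A|)%N by apply/eqP; rewrite eqn_leq le1.
  by move: oddF; rewrite e2 mul2n odd_double.
case/imsetP=> _ /imsetP[t _ ->] e; exists u, t; rewrite e; ring.
Qed.

(** For a matrix [u] with rows [(a, b)] and [(c, d)], trace -1 and determinant 1,
    this binary quadratic form sends [v = (s, t)] to the determinant of the rows
    [v] and [v u]; its discriminant is -3. In odd characteristic completing the
    square leads to [two_squares]; in characteristic 2 a nonzero coefficient of
    [s ^+ 2] or [t ^+ 2] suffices, since every scalar is a square. *)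
Lemma cyclic_form_represents_1 (a b c d : F) : (3%:R : F) != 0 ->
  a + d = -1 -> a * d - b * c = 1 ->
  exists s t, b * s ^+ 2 + (d - a) * s * t - c * t ^+ 2 = 1.
Proof.
move=> nz3 tr1 det1.
have disc : (d - a) ^+ 2 + 4%:R * b * c = - 3%:R.
  apply: (lincomb (k := 1) (l := (a + d) ^+ 2 - 4%:R * (a * d - b * c))
    (r := - 3%:R)); last by ring.
  by rewrite tr1 det1; ring.
have [b0 | nzb] := eqVneq b 0.
  have [c0 | nzc] := eqVneq c 0.
    have nzda : d - a != 0.
      apply: contra nz3 => /eqP da; move: disc.
      rewrite da b0 expr0n /= mulr0 mul0r addr0 => /eqP.
      by rewrite eq_sym oppr_eq0.
    by exists 1, (d - a)^-1; rewrite b0 c0; field.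
  have [ch2 | nz2] := eqVneq (2%:R : F) 0.
    have [] := @sqrt_char2 (- c^-1); first by rewrite inE /= ch2 eqxx.
    by move=> t t2; exists 0, t; rewrite t2; field.
  have oF := odd_card_finField nz2.
  have [u [s e]] := @two_squares 1 3%:R (- (4%:R * c)) oF (oner_neq0 _) nz3.
  exists s, ((u + (d - a) * s) / (2%:R * c)).
  have nz4c : - (4%:R * c) != 0.
    by rewrite oppr_eq0 mulf_neq0 // (natrM F 2 2) mulf_neq0.
  apply: (mulfI nz4c); rewrite b0 mulr1 -[RHS]e; move: disc; rewrite b0 => disc.
  apply: (lincomb (k := - s ^+ 2) disc); field.
  by rewrite nzc.
have [ch2 | nz2] := eqVneq (2%:R : F) 0.
  have [] := @sqrt_char2 b^-1; first by rewrite inE /= ch2 eqxx.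
  by move=> t t2; exists t, 0; rewrite t2; field.
have oF := odd_card_finField nz2.
have [u [t e]] := @two_squares 1 3%:R (4%:R * b) oF (oner_neq0 _) nz3.
exists ((u - (d - a) * t) / (2%:R * b)), t.
have nz4b : 4%:R * b != 0 by rewrite mulf_neq0 // (natrM F 2 2) mulf_neq0.
apply: (mulfI nz4b); rewrite mulr1 -[RHS]e.
apply: (lincomb (k := - t ^+ 2) disc); field.
by rewrite nzb.
Qed.

Lemma exists_root_of_unity (l : nat) : prime l -> (l %| #|F|.-1)%N ->
  exists2 a : F, a != 1 & a ^+ l = 1.
Proof.
move=> pr_l; rewrite -card_finField_unit => dv.
have [u _ ou] := @Cauchy _ l [set: {unit F}]%G pr_l dv.
exists (val u); last first.
  by rewrite -FinRing.val_unitX -ou expg_order FinRing.val_unit1.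
apply: contraTneq (prime_gt1 pr_l) => u1.
by rewrite -ou (_ : u = 1%g) ?order1 //; apply: val_inj.
Qed.

Lemma cube_root_even (k : nat) : #|F| = (2 ^ k)%N -> ~~ odd k ->
  exists w : F, w ^+ 2 + w + 1 = 0.
Proof.
move=> oF even_k; have [||w w1 w3] := @exists_root_of_unity 3 => //.
  rewrite oF -(even_halfK even_k) -mul2n expnM.
  exact: (dvdn_pred_predX (2 ^ 2)).
exists w; have nz : w - 1 != 0 by rewrite subr_eq0.
by apply: (mulfI nz); apply: (lincomb (k := 1) w3); ring.
Qed.

(** As 2 ^ k = 2 modulo 3, a root [w] satisfies [w = w ^+ (2 ^ k) = w ^+ 2]. *)
Lemma no_cube_root_odd (k : nat) (w : F) : #|F| = (2 ^ k)%N -> odd k ->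
  w ^+ 2 + w + 1 != 0.
Proof.
move=> oF odd_k; apply/eqP=> ew.
have w3 : w ^+ 3 = 1 by apply: (lincomb (k := w - 1) ew); ring.
have := expf_card w; rewrite oF (divn_eq (2 ^ k) 3) exprD mulnC exprM w3 expr1n.
have -> : (2 ^ k %% 3 = 2)%N.
  rewrite -(odd_double_half k) odd_k -mul2n expnD expnM -modnMmr.
  by rewrite -modnXm exp1n.
rewrite mul1r => w2.
have nzw : w != 0.
  apply: contraPneq w3 => ->; rewrite expr0n /= => /esym/eqP.
  by rewrite oner_eq0.
have w1 : w = 1 by apply: (mulfI nzw); rewrite mulr1 -expr2.
have ch2 : (2 \in [pchar F])%N by apply: card_finPcharP oF _.
have := ew; rewrite w1 expr1n => /eqP.
by rewrite -[1 + 1](natrD _ 1 1) (pcharf0 ch2) add0r oner_eq0.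
Qed.

(** The fixed points of the [r]-th power of the Frobenius map: they include the
    roots of unity of any prime order dividing [2 ^ r - 1], and they are at most
    [2 ^ r], being roots of a polynomial of that degree. *)
Lemma intermediate_subfield (k r : nat) : #|F| = (2 ^ k)%N ->
    (r %| k)%N -> (1 < r)%N -> (r < k)%N ->
  let K := [set a : F | a ^+ (2 ^ r) == a] in
  (exists2 t, t \in K & (t != 0) && (t != 1)) /\ (exists z, z \notin K).
Proof.
move=> oF rk r1 rltk K; split.
  have gt1 : (1 < (2 ^ r).-1)%N.
    have : (2 ^ 2 <= 2 ^ r)%N by rewrite leq_exp2l.
    by case: (2 ^ r)%N => [|[|[|]]].
  have [||t t1 tl] := @exists_root_of_unity (pdiv (2 ^ r).-1).
  - exact: pdiv_prime.
  - apply: dvdn_trans (pdiv_dvd _) _; rewrite oF -(divnK rk) mulnC expnM.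
    exact: dvdn_pred_predX.
  have nzt : t != 0.
    apply: contraPneq tl => ->; rewrite expr0n.
    by rewrite gtn_eqF ?pdiv_gt0 //= => /esym/eqP; rewrite oner_eq0.
  exists t; last by rewrite nzt.
  have /dvdnP[q e] := pdiv_dvd (2 ^ r).-1.
  rewrite inE -(prednK (_ : 0 < 2 ^ r)%N) ?expn_gt0 // exprS e mulnC exprM tl.
  by rewrite expr1n mulr1.
have [/existsP[z nz] | /existsPn allK] := boolP [exists z, z \notin K].
  by exists z.
pose P : {poly F} := 'X^(2 ^ r) - 'X.
have szX : (size (- 'X : {poly F}) < (2 ^ r).+1)%N.
  rewrite size_polyN size_polyX ltnS.
  exact: (leq_pexp2l (isT : 0 < 2)%N (ltnW r1)).
have szP : size P = (2 ^ r).+1 by rewrite size_polyDl size_polyXn.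
have nzP : P != 0 by rewrite -size_poly_eq0 szP.
have allP : all (root P) (enum F).
  apply/allP=> a _; rewrite rootE !hornerE subr_eq0.
  by have := allK a; rewrite negbK inE.
have := max_poly_roots nzP allP (enum_uniq F).
by rewrite szP -cardE oF ltnS leq_exp2l // leqNgt rltk.
Qed.

Lemma subfield_exp_closed (k r : nat) : #|F| = (2 ^ k)%N ->
  let K := [set a : F | a ^+ (2 ^ r) == a] in
  [/\ 1 \in K, {in K, forall a, - a \in K}, {in K, forall a, a^-1 \in K},
      {in K &, forall a b, a + b \in K} & {in K &, forall a b, a * b \in K}].
Proof.
move=> oF K; have ch2 : (2 \in [pchar F])%N by apply: card_finPcharP oF _.
split=> [|a|a|a b|a b]; rewrite !inE ?expr1n //.
- by rewrite (oppr_pchar2 ch2).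
- by rewrite exprVn => /eqP->.
- move=> /eqP Ka /eqP Kb; rewrite exprDn_pchar ?Ka ?Kb //.
  by rewrite (eq_pnat _ (pcharf_eq ch2)) pnatX pnat_id.
by move=> /eqP Ka /eqP Kb; rewrite exprMn Ka Kb.
Qed.

(** A field of prime degree has no subfields besides the prime field and itself,
    so that [c] generates it; [B] is a nonzero module over the polynomials in
    [c]. *)
Lemma prime_degree_generated (k : nat) (c : F) (B : {set F}) :
    #|F| = (2 ^ k)%N -> prime k -> c != 0 -> c != 1 -> 1 \in B ->
    {in B &, forall a b, a + b \in B} -> {in B, forall b, c * b \in B} ->
  forall b, b \in B.
Proof.
move=> oF pr_k nzc nc1 B1 BD Bc b.
have ch2 : (2 \in [pchar F])%N by apply: card_finPcharP oF _.
pose L : splittingFieldType 'F_2 := pPrimeCharType ch2.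
pose E : {subfield L} := <<1; (c : L)>>%AS.
have dL : \dim {: L} = k.
  by rewrite (pprimeChar_dimf ch2) oF pfactorK.
have Fp (a : L) : a \in 1%VS -> a = 0 \/ a = 1.
  case/vlineP=> l ->; have [-> | ->] : l = 0 \/ l = 1.
  - by case: l => [[|[|//]] ?]; [left | right]; apply: val_inj.
  - by left; rewrite scale0r.
  by right; rewrite scale1r.
have : (\dim E %| k)%N by rewrite -dL; apply/field_dimS/subvf.
case/(elimT primeP pr_k).2/orP => /eqP dE.
  have E1 : (1%VS = E :> {vspace L}).
    by apply/eqP; rewrite eqEdim sub1v dimv1 dE.
  have : (c : L) \in E by apply: memv_adjoin.
  by rewrite -E1 => /Fp[] e; move: nzc nc1; rewrite e eqxx.
have B0 : 0 \in B by rewrite -(pcharf0 ch2) mulr2n BD.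
have Eb : (b : L) \in E.
  have -> : (E = fullv :> {vspace L}).
    by apply/eqP; rewrite eqEdim subvf dE dL /=.
  exact: memvf.
have /Fadjoin_polyP[p p1 ->] := Eb.
rewrite horner_coef; apply: (big_ind (fun a : F => a \in B)) => // i _.
have cB : c ^+ i \in B.
  by elim: (nat_of_ord i) => [|n IH]; rewrite ?expr0 // exprS Bc.
have /Fp[-> | ->] := polyOverP p1 i; first by rewrite mul0r.
by rewrite mul1r.
Qed.

End FiniteFields.

(** * Coordinates on SL(2, F) *)

Section Matrices2.

Variable F : fieldType.
Local Open Scope ring_scope.

Definition mx2 (a b c d : F) : 'M[F]_2 :=
  \matrix_(i, j) if i == 0 then if j == 0 then a else b
                 else if j == 0 then c else d.

Lemma mx2_eta (M : 'M[F]_2) : M = mx2 (M 0 0) (M 0 1) (M 1 0) (M 1 1).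
Proof.
apply/matrixP=> i j; rewrite mxE.
by case: i => [[|[|//]] ?]; case: j => [[|[|//]] ?] /=;
   congr (M _ _); apply: val_inj.
Qed.

Lemma mx2_inj (a b c d a' b' c' d' : F) : mx2 a b c d = mx2 a' b' c' d' ->
  [/\ a = a', b = b', c = c' & d = d'].
Proof.
by move/matrixP=> e; move: (e 0 0) (e 0 1) (e 1 0) (e 1 1); rewrite !mxE.
Qed.

Lemma mulmx2 (a b c d a' b' c' d' : F) : mx2 a b c d *m mx2 a' b' c' d' =
  mx2 (a * a' + b * c') (a * b' + b * d') (c * a' + d * c') (c * b' + d * d').
Proof.
by rewrite [LHS]mx2_eta !mxE !big_ord_recl !big_ord0 !mxE /= !addr0.
Qed.

Lemma det_mx2 (a b c d : F) : \det (mx2 a b c d) = a * d - b * c.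
Proof.
rewrite (expand_det_row _ ord0) !big_ord_recl big_ord0 /cofactor !det_mx11.
rewrite !mxE /= addr0 expr0 mul1r expr1 mulN1r mulrN.
by congr (_ - _); congr (_ * _).
Qed.

Lemma tr_mx2 (a b c d : F) : \tr (mx2 a b c d) = a + d.
Proof. by rewrite /mxtrace !big_ord_recl big_ord0 !mxE /= addr0. Qed.

Lemma det2M (a b c d a' b' c' d' : F) :
    a * d - b * c = 1 -> a' * d' - b' * c' = 1 ->
  (a * a' + b * c') * (c * b' + d * d') - (a * b' + b * d') * (c * a' + d * c')
    = 1.
Proof.
move=> e e'; transitivity ((a * d - b * c) * (a' * d' - b' * c')).
  by ring.
by rewrite e e' mulr1.
Qed.

End Matrices2.

(** The arguments below take place in an abstract group identified by [m] with
    the matrices of determinant 1: they only depend on matrix entries, and no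
    computation ever has to look inside the type of invertible matrices. *)
Record SL2_model (F : finFieldType) (gT : finGroupType) (G : {group gT})
    (m : gT -> 'M[F]_2) : Prop := SL2Model {
  modelM : {in G &, {morph m : u v / u * v >-> (u *m v)%R}};
  model_inj : {in G &, injective m};
  model_im : forall M, (\det M = 1)%R <-> (exists2 u, u \in G & m u = M)
}.

Lemma SL2_modelP (F : finFieldType) :
  SL2_model (SL_group 2 F) (fun u => GLval u : 'M[F]_2).
Proof.
split=> [u v _ _ | u v _ _ | M].
- exact: (@GL_MxE 2 F u v).
- by move=> e; apply: (@val_inj _ _ {'GL_2[F]}).
split=> [dM | [u]]; last by rewrite inE => /eqP du <-.
have uM : M \in unitmx by rewrite unitmxE dM unitr1.
pose u : {'GL_2[F]} := insubd (1%g : {'GL_2[F]}) M.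
have vu : GLval u = M by rewrite /u insubdK.
by exists u; rewrite // inE vu dM.
Qed.

Section SL2.

Variables (F : finFieldType) (gT : finGroupType) (G : {group gT}).
Variable m : gT -> 'M[F]_2.
Hypothesis model : SL2_model G m.
Local Open Scope ring_scope.

Fact sl2_key : unit. Proof. by []. Qed.

(** The group element with the given entries, provided that their determinant is
    1. It is locked to keep unification from unfolding the choice. *)
Definition sl2 : F -> F -> F -> F -> gT := locked_with sl2_key
  (fun a b c d => odflt 1%g [pick u in G | m u == mx2 a b c d]).

Lemma sl2P (a b c d : F) : a * d - b * c = 1 ->
  sl2 a b c d \in G /\ m (sl2 a b c d) = mx2 a b c d.
Proof.
move=> e; rewrite /sl2 unlock; case: pickP => [u /andP[Gu /eqP mu] // | no].
have [|u Gu mu] := (model_im model (mx2 a b c d)).1; first by rewrite det_mx2.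
by have := no u; rewrite /= Gu mu eqxx.
Qed.

Lemma sl2_in (a b c d : F) : a * d - b * c = 1 -> sl2 a b c d \in G.
Proof. by case/sl2P. Qed.

Lemma val_sl2 (a b c d : F) : a * d - b * c = 1 ->
  m (sl2 a b c d) = mx2 a b c d.
Proof. by case/sl2P. Qed.

Lemma SL2P u : u \in G ->
  exists a b c d : F, a * d - b * c = 1 /\ u = sl2 a b c d.
Proof.
move=> Gu; have := (model_im model (m u)).2 (ex_intro2 _ _ u Gu erefl).
rewrite [m u]mx2_eta det_mx2 => e; do 4!eexists; split; first exact: e.
by apply: (model_inj model) => //; rewrite ?sl2_in // val_sl2 // -mx2_eta.
Qed.

Lemma sl2M (a b c d a' b' c' d' : F) :
    a * d - b * c = 1 -> a' * d' - b' * c' = 1 ->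
  (sl2 a b c d * sl2 a' b' c' d')%g =
    sl2 (a * a' + b * c') (a * b' + b * d') (c * a' + d * c') (c * b' + d * d').
Proof.
move=> e e'; have e2 := det2M e e'.
apply: (model_inj model); rewrite ?groupM ?sl2_in //.
by rewrite (modelM model) ?sl2_in // !val_sl2 // mulmx2.
Qed.

Lemma sl2_1 : sl2 1 0 0 1 = 1%g.
Proof.
have e : (1 : F) * 1 - 0 * 0 = 1 by ring.
apply: (mulgI (sl2 1 0 0 1)); rewrite mulg1 sl2M //.
by congr sl2; ring.
Qed.

Lemma sl2_inj (a b c d a' b' c' d' : F) :
    a * d - b * c = 1 -> a' * d' - b' * c' = 1 ->
  sl2 a b c d = sl2 a' b' c' d' -> [/\ a = a', b = b', c = c' & d = d'].
Proof. by move=> e e' /(congr1 m); rewrite !val_sl2 //; apply: mx2_inj. Qed.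

Lemma sl2V (a b c d : F) : a * d - b * c = 1 ->
  (sl2 a b c d)^-1%g = sl2 d (- b) (- c) a.
Proof.
move=> e; have e' : d * a - - b * - c = 1 by rewrite -e; ring.
apply/eqP; rewrite eq_invg_mul sl2M // -sl2_1; apply/eqP.
by congr sl2; rewrite -?e; ring.
Qed.

Definition trace (u : gT) : F := \tr (m u).

Lemma trace_sl2 (a b c d : F) : a * d - b * c = 1 ->
  trace (sl2 a b c d) = a + d.
Proof. by move=> e; rewrite /trace val_sl2 // tr_mx2. Qed.

Lemma traceJ u v : u \in G -> v \in G -> trace (u ^ v)%g = trace u.
Proof.
move=> Gu Gv; rewrite /trace conjgE (modelM model) ?groupM ?groupV //.
rewrite mxtrace_mulC -(modelM model) ?groupM ?groupV //.
by rewrite -mulgA mulgV mulg1.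
Qed.

Lemma sl2_commute (a b c d a' b' c' d' : F) :
    a * d - b * c = 1 -> a' * d' - b' * c' = 1 ->
  commute (sl2 a b c d) (sl2 a' b' c' d') ->
  [/\ b * c' = b' * c, a * b' + b * d' = a' * b + b' * d
    & c * a' + d * c' = c' * a + d' * c].
Proof.
move=> e e'; rewrite /commute !sl2M //.
move/sl2_inj=> /(_ (det2M e e') (det2M e' e)) [h1 h2 h3 _]; split=> //.
by apply: (lincomb (k := 1) h1); ring.
Qed.

Lemma sl2_commuteE (a b c d a' b' c' d' : F) :
    a * d - b * c = 1 -> a' * d' - b' * c' = 1 ->
    b * c' = b' * c -> a * b' + b * d' = a' * b + b' * d ->
    c * a' + d * c' = c' * a + d' * c ->
  commute (sl2 a b c d) (sl2 a' b' c' d').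
Proof.
move=> e e' h1 h2 h3; rewrite /commute !sl2M // h2 h3.
congr sl2; first by rewrite h1; ring.
by apply: (lincomb (k := -1) h1); ring.
Qed.

(** * The elements of order 3 *)

Local Notation Z := 'Z(G)%g.

Lemma center_SL2P z :
  reflect (exists2 e : F, e * e = 1 & z = sl2 e 0 0 e) (z \in Z).
Proof.
apply: (iffP (centerP G z)) => [[/SL2P[a [b [c [d [e ->]]]]] cz] | [e e1 ->]].
  have e1 : (1 : F) * 1 - 1 * 0 = 1 by ring.
  have e2 : (1 : F) * 1 - 0 * 1 = 1 by ring.
  have [h1 h2 _] := sl2_commute e e1 (cz _ (sl2_in e1)).
  have [h4 h5 h6] := sl2_commute e e2 (cz _ (sl2_in e2)).
  have c0 : c = 0 by apply: (lincomb (k := -1) h1); ring.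
  have b0 : b = 0 by apply: (lincomb (k := 1) h4); ring.
  have da : d = a by apply: (lincomb (k := 1) h6); ring.
  by exists a; move: e; rewrite da b0 c0 ?mul0r ?subr0.
have e0 : e * e - 0 * 0 = 1 by rewrite mul0r subr0.
split=> [|_ /SL2P[a [b [c [d [h ->]]]]]]; first exact: sl2_in.
by apply: sl2_commuteE => //; ring.
Qed.

Lemma trace_1 : trace 1%g = 2%:R.
Proof. by rewrite -sl2_1 trace_sl2; ring. Qed.

(** By Cayley-Hamilton an element of trace -1 is a root of X^2 + X + 1, which
    divides X^3 - 1. *)
Lemma traceN1_expg3 u : u \in G -> trace u = -1 -> (u ^+ 3 = 1)%g.
Proof.
move=> /SL2P[a [b [c [d [e ->]]]]]; rewrite trace_sl2 // => t.
have d' : d = -1 - a by rewrite -t; ring.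
suff uu : (sl2 a b c d * sl2 a b c d = (sl2 a b c d)^-1)%g.
  by rewrite !expgS expg0 mulg1 uu mulgV.
rewrite sl2V // sl2M //; congr sl2; rewrite ?d'.
- by apply: (lincomb (k := -1) e); rewrite d'; ring.
- by ring.
- by ring.
by apply: (lincomb (k := -1) e); rewrite d'; ring.
Qed.

Lemma traceN1_notin_center u :
  (3%:R : F) != 0 -> trace u = -1 -> u \notin Z.
Proof.
move=> nz3 t; apply/center_SL2P=> -[e e1 eu]; move: t; rewrite eu trace_sl2.
  move=> t; case/eqP: nz3.
  have -> : 3%:R = 4%:R * (e * e) - (1 : F) by rewrite e1; ring.
  apply: (lincomb (k := e + e - 1) t); ring.
by rewrite mul0r subr0.
Qed.

Lemma order3_coset u : (3%:R : F) != 0 -> u \in G -> trace u = -1 ->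
  #[coset Z u]%g = 3%N.
Proof.
move=> nz3 Gu t.
have nZ : u \in 'N(Z)%g by apply: (subsetP (normal_norm (center_normal _))).
apply: nt_prime_order => //.
  by rewrite -morphX ?traceN1_expg3 ?morph1.
by apply: contraNneq (traceN1_notin_center nz3 t) => /(coset_idr nZ).
Qed.

Lemma SL2_norm_center u : u \in G -> u \in 'N(Z)%g.
Proof. by apply/subsetP/normal_norm/center_normal. Qed.

(** A lift has a central cube, and can be chosen with cube 1. It is not scalar,
    so that its minimal polynomial is its characteristic polynomial; having
    determinant 1 this can only be X^2 + X + 1. *)
Lemma order3_lift x : x \in (G / Z)%g -> #[x]%g = 3%N ->
  exists2 u, u \in G & trace u = -1 /\ x = coset Z u.
Proof.
case/morphimP=> u0 nZu0 Gu0 /= -> ox.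
have x3 : (coset Z u0 ^+ 3 = 1)%g by rewrite -ox expg_order.
have Zu3 : (u0 ^+ 3)%g \in Z.
  by apply: coset_idr; rewrite ?groupX // morphX.
case/center_SL2P: (Zu3) => e e1 ue.
have e0 : e * e - 0 * 0 = 1 by rewrite mul0r subr0.
have Ze : sl2 e 0 0 e \in Z by apply/center_SL2P; exists e.
(* The cube of u0 is a central square root of 1; multiplying u0 by it makes the
   cube trivial. *)
set u := (u0 * sl2 e 0 0 e)%g.
have Gu : u \in G by rewrite groupM // sl2_in.
have u3 : (u ^+ 3 = 1)%g.
  have cz : commute u0 (sl2 e 0 0 e) by have /centerP[_] := Ze; move/(_ u0 Gu0).
  have ee : (sl2 e 0 0 e ^+ 2 = 1)%g.
    by rewrite expgS expg1 sl2M // -sl2_1; congr sl2; rewrite ?e1; ring.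
  by rewrite expgMn // ue -expgS (expgM _ 2 2) ee expg1n.
have xu : coset Z u0 = coset Z u.
  by rewrite morphM ?SL2_norm_center ?sl2_in //= (coset_id Ze) mulg1.
have nZu : u \notin Z.
  by apply: contraTN (isT : 1 < 3)%N => Zu; rewrite -ox xu coset_id // order1.
exists u => //; split=> //.
have /SL2P[a [b [c [d [dt eu]]]]] := Gu; rewrite eu trace_sl2 //.
have : (u * u = u^-1)%g.
  by apply/esym/eqP; rewrite eq_invg_mul -u3 !expgS expg0 mulg1.
rewrite eu sl2V // sl2M // => /sl2_inj[].
- exact: det2M.
- by rewrite -dt; ring.
move=> h1 h2 h3 h4.
have [b0 | nzb] := eqVneq b 0; last first.
  by apply: (mulfI nzb); rewrite mulrN1 -h2; ring.
have [c0 | nzc] := eqVneq c 0; last first.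
  by apply: (mulfI nzc); rewrite mulrN1 -h3; ring.
have nzad : a - d != 0.
  apply: contra nZu => /eqP/subr0_eq ad; apply/center_SL2P; exists a.
    by move: dt; rewrite b0 c0 -ad mul0r subr0.
  by rewrite eu b0 c0 -ad.
apply: (mulfI nzad); rewrite b0 in h1 h4.
transitivity ((a * a + 0 * c) - (c * 0 + d * d)); first by ring.
by rewrite h1 h4; ring.
Qed.

Definition companion := sl2 0 1 (-1) (-1).

Lemma companion_det : (0 : F) * (-1) - 1 * (-1) = 1.
Proof. by ring. Qed.

(** The base change has rows [w] and [w u], where the row vector [w] is chosen so
    that the determinant is 1 and not just nonzero; conjugacy therefore takes
    place in SL(2, F) and not only in GL(2, F). *)
Lemma traceN1_conj_companion u : (3%:R : F) != 0 -> u \in G -> trace u = -1 ->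
  exists2 v, v \in G & u = (companion ^ v)%g.
Proof.
move=> nz3 /SL2P[a [b [c [d [e ->]]]]]; rewrite trace_sl2 // => t.
have [s [r q]] := cyclic_form_represents_1 nz3 t e.
have det : s * (s * b + r * d) - r * (s * a + r * c) = 1.
  by rewrite -q; ring.
exists (sl2 s r (s * a + r * c) (s * b + r * d)); first exact: sl2_in.
have ec := companion_det.
apply: (mulgI (sl2 s r (s * a + r * c) (s * b + r * d))); rewrite conjgE mulKVg.
have d' : d = -1 - a by rewrite -t; ring.
rewrite /companion !sl2M //; congr sl2; first by ring.
- by ring.
- by apply: (lincomb (k := - s) e); rewrite d'; ring.
by apply: (lincomb (k := - r) e); rewrite d'; ring.
Qed.

Theorem order3_conj x y : (3%:R : F) != 0 ->
  x \in (G / Z)%g -> #[x]%g = 3%N -> y \in (G / Z)%g -> #[y]%g = 3%N ->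
  y \in (x ^: (G / Z))%g.
Proof.
move=> nz3 Gx ox Gy oy.
have [u Gu [tu ->]] := order3_lift Gx ox.
have [v Gv [tv ->]] := order3_lift Gy oy.
have [g Gg ->] := traceN1_conj_companion nz3 Gu tu.
have [h Gh ->] := traceN1_conj_companion nz3 Gv tv.
have Gw : companion \in G := sl2_in companion_det.
apply/imsetP; exists (coset Z (g^-1 * h)%g).
  by apply: mem_morphim; rewrite ?SL2_norm_center ?groupM ?groupV.
by rewrite -morphJ ?SL2_norm_center ?groupM ?groupJ ?groupV // -conjgM mulKVg.
Qed.

Lemma class_order3 x y : (3%:R : F) != 0 -> x \in (G / Z)%g -> #[x]%g = 3%N ->
  (y \in (x ^: (G / Z))%g) = (y \in (G / Z)%g) && (#[y]%g == 3%N).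
Proof.
move=> nz3 Gx ox; apply/idP/andP=> [/imsetP[g Gg ->] | [Gy /eqP oy]].
  by rewrite groupJ // orderJ ox.
exact: order3_conj.
Qed.

(** * Proper non-abelian subracks *)

Section NotMinimal.

Hypothesis nz3 : (3%:R : F) != 0.
Variables (x : coset_of Z) (Gx : x \in (G / Z)%g).
Hypothesis ox : #[x]%g = 3%N.

(** All elements of order 3 being conjugate, the normalizing element may be any
    of them. *)
Lemma normalizing_order3_not_minimal (V : {group coset_of Z}) u :
    u \in G -> trace u = -1 -> V \subset (G / Z)%g -> abelian V ->
    coset Z u \in 'N(V)%g -> coset Z u \notin 'C(V)%g -> ~~ (3 %| #|V|)%N ->
  ~ minimal_nonabelian (class_rack Gx).
Proof.
move=> Gu tu sVG abV nV ncV n3V min.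
have ou := order3_coset nz3 Gu tu.
have Gu' : coset Z u \in (G / Z)%g by apply: mem_quotient.
apply: (normalized_abelian_not_minimal (Gx := Gu') sVG abV nV ncV ou n3V).
  by rewrite class_order3 // groupV orderV ou Gu'.
apply: class_rack_minimal_eq min; apply/esym/class_eqP.
by rewrite class_order3 // Gu' ou.
Qed.

Lemma coset_eq u v : u \in G -> v \in G ->
  coset Z u = coset Z v -> (u^-1 * v)%g \in Z.
Proof.
move=> Gu Gv e; apply: coset_idr.
  by rewrite SL2_norm_center ?groupM ?groupV.
by rewrite morphM ?morphV ?groupV ?SL2_norm_center //= e mulVg.
Qed.

Lemma coset_commute u v z : u \in G -> v \in G -> z \in Z ->
  (u * v = v * u * z)%g -> commute (coset Z u) (coset Z v).
Proof.
move=> Gu Gv Zz e; rewrite /commute -!morphM ?SL2_norm_center //= e.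
have Gz : z \in G by case/centerP: Zz.
by rewrite morphM ?SL2_norm_center ?groupM //= (coset_id Zz) mulg1.
Qed.

(** In odd characteristic the norm form of the quaternions is isotropic, which
    puts a quaternion group of order 8, normalized by an element of order 3,
    inside SL(2, F); its image is the Klein subgroup of an alternating group of
    degree 4. *)
Lemma odd_char_not_minimal :
  (2%:R : F) != 0 -> ~ minimal_nonabelian (class_rack Gx).
Proof.
move=> nz2.
have [al [be]] := two_squares (-1 : F) (odd_card_finField nz2)
  (oner_neq0 F) (oner_neq0 F).
rewrite !mul1r => ab.
pose i := sl2 0 1 (-1) 0; pose j := sl2 al be be (- al).
pose k := sl2 be (- al) (- al) (- be).
(* u is the quaternion (- 1 + i + j + k) / 2, which permutes i, j, k cyclically. *)
pose h : F := 2%:R^-1.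
have h2 : 2%:R * h = 1 by rewrite mulfV.
pose u := sl2 (h * (-1 + al + be)) (h * (1 + be - al)) (h * (-1 + be - al))
              (h * (-1 - al - be)).
have di : (0 : F) * 0 - 1 * -1 = 1 by ring.
have dj : al * - al - be * be = 1 by apply: (lincomb (k := -1) ab); ring.
have dk : be * - be - (- al) * (- al) = 1.
  by apply: (lincomb (k := -1) ab); ring.
have du : h * (-1 + al + be) * (h * (-1 - al - be)) -
          h * (1 + be - al) * (h * (-1 + be - al)) = 1.
  transitivity (h * h * (2%:R - 2%:R * (al ^+ 2 + be ^+ 2))); first by ring.
  rewrite ab; transitivity ((2%:R * h) * (2%:R * h)); first by ring.
  by rewrite h2 mulr1.
have [Gi Gj Gu] : [/\ i \in G, j \in G & u \in G].
  by split; apply: sl2_in.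
have tu : trace u = -1.
  by rewrite trace_sl2 //; apply: (lincomb (k := -1) h2); ring.
have d1 : (-1 : F) * -1 - 0 * 0 = 1 by ring.
have Zm : sl2 (-1) 0 0 (-1) \in Z.
  by apply/center_SL2P; exists (-1) => //; ring.
have ij : (i * j = k)%g by rewrite sl2M //; congr sl2; ring.
have ji : (i * j = j * i * sl2 (-1) 0 0 (-1))%g.
  by rewrite !sl2M //; [congr sl2; ring | exact: (det2M dj di)].
have ii : (i * i = sl2 (-1) 0 0 (-1))%g by rewrite sl2M //; congr sl2; ring.
have jj : (j * j = sl2 (-1) 0 0 (-1))%g.
  rewrite sl2M //; congr sl2; last 1 first.
  - by apply: (lincomb (k := 1) ab); ring.
  - by apply: (lincomb (k := 1) ab); ring.
  - by ring.
  by ring.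
have iu : (i ^ u = j)%g.
  apply: (mulgI u); rewrite conjgE mulKVg !sl2M //; congr sl2.
  - by apply: (lincomb (k := - h) ab); ring.
  - by apply: (lincomb (k := - h) ab); ring.
  - by apply: (lincomb (k := h) ab); ring.
  by apply: (lincomb (k := - h) ab); ring.
have ju : (j ^ u = k)%g.
  apply: (mulgI u); rewrite conjgE mulKVg !sl2M //; congr sl2; ring.
pose I := coset Z i; pose J := coset Z j.
have cIJ : commute I J by apply: (coset_commute Gi Gj Zm).
have I2 : (I ^+ 2 = 1)%g.
  by rewrite expgS expg1 -morphM ?SL2_norm_center //= ii coset_id.
have J2 : (J ^+ 2 = 1)%g.
  by rewrite expgS expg1 -morphM ?SL2_norm_center //= jj coset_id.
have JG : J \in (G / Z)%g by apply: mem_quotient.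
have IG : I \in (G / Z)%g by apply: mem_quotient.
have VE : (<<[set I; J]>> = <[I]> * <[J]>)%g.
  rewrite -cent_joinEr; last exact/cents_cycle/commute_sym.
  by rewrite joing_idl joing_idr.
have VI : I \in <<[set I; J]>>%g by rewrite mem_gen // !inE eqxx.
have VJ : J \in <<[set I; J]>>%g by rewrite mem_gen // !inE eqxx orbT.
apply: (@normalizing_order3_not_minimal <<[set I; J]>>%G u) => //=.
- by rewrite gen_subG; apply/subsetP=> y /set2P[] ->.
- by rewrite abelian_gen; apply/centsP=> y /set2P[]-> z /set2P[]->.
- rewrite inE -genJ gen_subG; apply/subsetP=> _ /imsetP[y /set2P[] -> ->].
    by rewrite -morphJ ?SL2_norm_center //= iu.
  rewrite -morphJ ?SL2_norm_center //= ju -ij.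
  by rewrite morphM ?SL2_norm_center ?groupM.
- (* If u centralized I then i and j would agree up to sign. *)
  apply/centP=> /(_ I VI)/commute_sym/commgP/conjg_fixP.
  rewrite -morphJ ?SL2_norm_center //= iu => /(coset_eq Gj Gi).
  rewrite sl2V // sl2M //; last by rewrite -dj; ring.
  case/center_SL2P=> e e1 /sl2_inj[].
  - by apply: det2M => //; rewrite -dj; ring.
  - by rewrite e1 mul0r subr0.
  move=> h1 h5 _ h4; case/eqP: (oner_neq0 F); rewrite -[1]opprK -ab.
  have be0 : be = 0.
    apply: (mulfI nz2); rewrite mulr0.
    by apply: (lincomb (k := 1) (etrans h1 (esym h4))); ring.
  have al0 : al = 0 by apply: (lincomb (k := -1) h5); ring.
  by rewrite be0 al0; ring.
have pV : 2.-group <<[set I; J]>>%g.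
  rewrite VE pgroupM; apply/andP; split; rewrite /pgroup.
    by apply: (pnat_dvd (n := 2)) => //; rewrite order_dvdn I2.
  by apply: (pnat_dvd (n := 2)) => //; rewrite order_dvdn J2.
by apply/negP=> /(pgroupP pV 3 isT).
Qed.

End NotMinimal.

Definition upper (b : F) : gT := sl2 1 b 0 1.

Lemma upper_det (b : F) : 1 * 1 - b * 0 = 1.
Proof. by rewrite mul1r mulr0 subr0. Qed.

Lemma upper_in b : upper b \in G.
Proof. exact/sl2_in/upper_det. Qed.

Lemma upperM b c : (upper b * upper c)%g = upper (b + c).
Proof.
rewrite /upper sl2M; [|exact: upper_det|exact: upper_det].
by congr sl2; ring.
Qed.

Lemma upper0 : upper 0 = 1%g.
Proof. exact: sl2_1. Qed.

Lemma upperV b : (upper b)^-1%g = upper (- b).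
Proof. by apply/eqP; rewrite eq_invg_mul upperM subrr upper0. Qed.

Lemma upper_center b : upper b \in Z -> b = 0.
Proof.
case/center_SL2P=> e e1 /sl2_inj[] //; first exact: upper_det.
by rewrite e1 mul0r subr0.
Qed.

Lemma upper_inj : injective upper.
Proof. by move=> b c /sl2_inj[||//]; apply: upper_det. Qed.

Lemma upper_group_set : group_set [set upper b | b in F].
Proof.
apply/group_setP; split; first by apply/imsetP; exists 0; rewrite ?upper0.
move=> _ _ /imsetP[b _ ->] /imsetP[c _ ->]; rewrite upperM.
by apply/imsetP; exists (b + c).
Qed.

Definition upper_group := group upper_group_set.

Lemma upperJ (a b d t : F) : a * d - b * 0 = 1 ->
  (upper t ^ sl2 a b 0 d)%g = upper (d ^+ 2 * t).
Proof.
move=> e; have e1 := upper_det; apply: (mulgI (sl2 a b 0 d)).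
rewrite conjgE mulKVg /upper !sl2M //; congr sl2.
- by ring.
- by apply: (lincomb (k := - d * t) e); ring.
- by ring.
by ring.
Qed.

(** When the field has a primitive cube root of unity an element of order 3 is
    diagonalizable, and it acts without fixed points on the unipotent group that
    it normalizes. *)
Lemma cube_root_not_minimal (nz3 : (3%:R : F) != 0) (n3F : ~~ (3 %| #|F|)%N)
    (x : coset_of Z) (Gx : x \in (G / Z)%g) (ox : #[x]%g = 3%N) (w : F) :
  w ^+ 2 + w + 1 = 0 -> ~ minimal_nonabelian (class_rack Gx).
Proof.
move=> ew.
have du : w * w ^+ 2 - 0 * 0 = 1 by apply: (lincomb (k := w - 1) ew); ring.
set u := sl2 w 0 0 (w ^+ 2).
have Gu : u \in G by apply: sl2_in.
have tu : trace u = -1.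
  by rewrite trace_sl2 //; apply: (lincomb (k := 1) ew); ring.
have sUG : upper_group \subset G.
  by apply/subsetP=> _ /imsetP[b _ ->]; apply: upper_in.
have uJ t : (upper t ^ u)%g = upper (w * t).
  rewrite upperJ //; congr upper.
  by apply: (lincomb (k := w * (w - 1) * t) ew); ring.
apply: (normalizing_order3_not_minimal nz3 ox (V := (upper_group / Z)%G) Gu tu).
- exact: quotientS.
- apply: quotient_abelian; apply/centsP=> _ /imsetP[b _ ->] _ /imsetP[c _ ->].
  by rewrite /commute !upperM addrC.
- apply: (subsetP (quotient_norm _ _)); apply: mem_quotient.
  rewrite inE; apply/subsetP=> _ /imsetP[_ /imsetP[b _ ->] ->]; rewrite uJ.
  by apply/imsetP; exists (w * b).
- have V1 : coset Z (upper 1) \in (upper_group / Z)%g.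
    by apply: mem_quotient; apply/imsetP; exists 1.
  apply/centP=> /(_ _ V1)/commute_sym/commgP/conjg_fixP.
  rewrite -morphJ ?SL2_norm_center ?upper_in //= uJ.
  move/(coset_eq (upper_in _) (upper_in _)).
  rewrite upperV upperM => /upper_center w1; case/eqP: nz3.
  have {}w1 : w = 1 by apply: (lincomb (k := -1) w1); ring.
  by rewrite -ew w1; ring.
apply: contra n3F => d3; apply: dvdn_trans d3 _.
have <- : #|upper_group| = #|F| by rewrite /= card_imset //; apply: upper_inj.
exact: dvdn_quotient.
Qed.

(** Elements of order 3 indexed by the nonzero scalars, distinguished by their
    upper right entry; [companion] has index 1. *)
Definition order3_elt (t : F) : gT := sl2 0 t (- t^-1) (-1).

Lemma order3_elt_det (t : F) : t != 0 -> 0 * (-1) - t * (- t^-1) = 1.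
Proof. by move=> nzt; field. Qed.

Lemma order3_elt_in (t : F) : t != 0 -> order3_elt t \in G.
Proof. by move=> nzt; apply/sl2_in/order3_elt_det. Qed.

Lemma order3_elt_trace (t : F) : t != 0 -> trace (order3_elt t) = -1.
Proof. by move=> nzt; rewrite trace_sl2 ?add0r //; apply: order3_elt_det. Qed.

Lemma order3_elt_class (nz3 : (3%:R : F) != 0) (t : F) (x : coset_of Z) :
    x \in (G / Z)%g -> #[x]%g = 3%N -> t != 0 ->
  coset Z (order3_elt t) \in (x ^: (G / Z))%g.
Proof.
move=> Gx ox nzt; have Gt := order3_elt_in nzt.
by rewrite class_order3 // mem_quotient //= order3_coset // order3_elt_trace.
Qed.

Lemma order3_elt_commute (t : F) : t != 0 -> t ^+ 2 != 1 ->
  ~ commute (coset Z (order3_elt 1)) (coset Z (order3_elt t)).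
Proof.
move=> nzt nt1; have Gt := order3_elt_in nzt.
have G1 := order3_elt_in (oner_neq0 F).
have dt := order3_elt_det nzt; have d1 := order3_elt_det (oner_neq0 F).
rewrite /commute -!morphM ?SL2_norm_center //.
move/(coset_eq (groupM G1 Gt) (groupM Gt G1))/center_SL2P=> [e e1].
have e0 : e * e - 0 * 0 = 1 by rewrite mul0r subr0.
move/(canRL (mulKg _)); rewrite invgK /order3_elt !sl2M //.
  case/sl2_inj=> [||_ h _ _]; [exact: det2M | exact: det2M (det2M _ _) e0 |].
  case/eqP: nt1; rewrite -e1 expr2.
  suff -> : t = e by [].
  by apply: (lincomb (k := -1) h); ring.
exact: det2M.
Qed.

(** The witness is the set of the elements of order 3 that have entries in the
    subfield [K]: it is proper because of [z], and not abelian because of [t]. *)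
Lemma subfield_not_minimal (nz3 : (3%:R : F) != 0) (x : coset_of Z)
    (Gx : x \in (G / Z)%g) (ox : #[x]%g = 3%N) (K : {set F}) (t z : F) :
    1 \in K -> {in K, forall a, - a \in K} ->
    {in K &, forall a b, a + b \in K} -> {in K &, forall a b, a * b \in K} ->
    t != 0 -> t \in K -> t^-1 \in K -> t ^+ 2 != 1 -> z \notin K ->
  ~ minimal_nonabelian (class_rack Gx).
Proof.
move=> K1 KN KD KM nzt Kt KtV nt1 nKz [_ min].
have K0 : 0 \in K by rewrite -(subrr 1) KD ?KN.
have nzz : z != 0 by apply: contraNneq nKz => ->.
pose L := [set u in G | [forall i, forall j, m u i j \in K]].
have Lsl2 a b c d : a * d - b * c = 1 -> (sl2 a b c d \in L) =
    [&& a \in K, b \in K, c \in K & d \in K].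
  move=> e; rewrite inE sl2_in //= val_sl2 //; apply/forallP/and4P.
    move=> h; have /forallP h0 := h 0; have /forallP h1 := h 1.
    by move: (h0 0) (h0 1) (h1 0) (h1 1); rewrite !mxE.
  move=> [Ka Kb Kc Kd] i; apply/forallP=> j; rewrite mxE.
  by case: ifP; case: ifP.
have gL : group_set L.
  apply/group_setP; split=> [|u v].
    by rewrite -sl2_1 Lsl2 ?K0 ?K1 // mul1r mul0r subr0.
  move=> Lu Lv; have Gu : u \in G by case/setIdP: Lu.
  have Gv : v \in G by case/setIdP: Lv.
  move: Lu Lv.
  case/SL2P: Gu => [a [b [c [d [e ->]]]]].
  case/SL2P: Gv => [a' [b' [c' [d' [e' ->]]]]].
  rewrite !Lsl2 // => /and4P[? ? ? ?] /and4P[? ? ? ?].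
  by rewrite sl2M // Lsl2; [rewrite !KD ?KM | exact: det2M].
pose Lb := (Group gL / Z)%G.
have Lt s : s != 0 -> s \in K -> s^-1 \in K -> coset Z (order3_elt s) \in Lb.
  move=> nzs Ks KsV; apply: mem_quotient.
  rewrite /= Lsl2; last exact: order3_elt_det.
  by rewrite K0 Ks !KN.
have C1 := order3_elt_class nz3 Gx ox (oner_neq0 F).
have L1 : coset Z (order3_elt 1) \in Lb.
  by apply: Lt; rewrite ?invr1 ?oner_neq0.
have Ct := order3_elt_class nz3 Gx ox nzt.
have sY := @subrack_setI _ _ Lb _ _ Gx C1 L1.
have pY : (x ^: (G / Z) :&: Lb)%g \proper (x ^: (G / Z))%g.
  apply/properP; split; first exact: subsetIl.
  exists (coset Z (order3_elt z)); first exact: order3_elt_class.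
  rewrite inE negb_and; apply/orP; right; apply: contra nKz.
  case/morphimP=> u _ Lu /= eu.
  have Gu : u \in G by case/setIdP: Lu.
  have := coset_eq Gu (order3_elt_in nzz) (esym eu).
  case/center_SL2P=> e e1 /(canRL (mulKg _)); rewrite invgK.
  have e0 : e * e - 0 * 0 = 1 by rewrite mul0r subr0.
  case/SL2P: Gu Lu => [a [b [c [d [dt ->]]]]].
  rewrite Lsl2 // => /and4P[_ Kb _ _].
  rewrite sl2M // => /sl2_inj[]; [exact: order3_elt_det | exact: det2M |].
  move=> _ -> _ _; rewrite mulr0 add0r; apply: KM => //.
  (* Modulo the center the upper right entry is determined up to sign. *)
  have : (e - 1) * (e + 1) = 0 by rewrite -(subrr (e * e)) {2}e1; ring.
  move/eqP; rewrite mulf_eq0 subr_eq0 addr_eq0 => /orP[] /eqP-> //.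
  exact: KN.
have abY := min _ sY pY.
apply: (order3_elt_commute nzt nt1); apply/conj_op_eq/abY; rewrite inE.
  by rewrite C1.
by rewrite Ct Lt.
Qed.

(** * Subgroups generated by elements of order 3 in characteristic 2 *)

Section CharTwo.

Hypothesis ch2 : (2 \in [pchar F])%N.

Let two0 : (2%:R : F) = 0. Proof. exact: pcharf0 ch2. Qed.

Let nz3 : (3%:R : F) != 0.
Proof. by rewrite (natrD _ 2 1) two0 add0r oner_eq0. Qed.

Lemma sqr_eq1_char2 (e : F) : e ^+ 2 = 1 -> e = 1.
Proof.
move=> e2; have : (e - 1) ^+ 2 == 0.
  rewrite (_ : _ ^+ 2 = e ^+ 2 - 1 + 2%:R * (1 - e)); last by ring.
  by rewrite e2 two0 subrr mul0r addr0.
by rewrite expf_eq0 subr_eq0 => /eqP.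
Qed.

Lemma center_char2 z : z \in Z -> z = 1%g.
Proof.
by case/center_SL2P=> e /sqr_eq1_char2 e1 ->; rewrite e1 sl2_1.
Qed.

Lemma coset_inj_char2 u v : u \in G -> v \in G ->
  coset Z u = coset Z v -> u = v.
Proof.
move=> Gu Gv /(coset_eq Gu Gv)/center_char2 /eqP.
by rewrite -eq_invg_mul invgK => /eqP.
Qed.

Lemma coset_commute_char2 u v : u \in G -> v \in G ->
  commute (coset Z u) (coset Z v) -> commute u v.
Proof.
move=> Gu Gv; rewrite /commute -!morphM ?SL2_norm_center //.
by apply: coset_inj_char2; rewrite groupM.
Qed.

(** The centralizer of a non-scalar matrix consists of its polynomials, and in
    characteristic 2 the only scalar matrix of determinant 1 is the identity. *)
Lemma commute_polynomial (a b c d a' b' c' d' : F) :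
    a * d - b * c = 1 -> a' * d' - b' * c' = 1 ->
    sl2 a b c d != 1%g -> commute (sl2 a b c d) (sl2 a' b' c' d') ->
  exists al be, [/\ a' = al + be * a, b' = be * b, c' = be * c
                  & d' = al + be * d].
Proof.
move=> e e' n1 /(sl2_commute e e')[h1 h2 h3].
have [b0 | nzb] := eqVneq b 0; last first.
  exists (a' - b' / b * a), (b' / b); split.
  - by rewrite subrK.
  - by rewrite divfK.
  - apply: (mulfI nzb); rewrite h1; field; exact: nzb.
  apply: (mulfI nzb); apply: (lincomb (k := 1) h2); field; exact: nzb.
have [c0 | nzc] := eqVneq c 0; last first.
  exists (a' - c' / c * a), (c' / c); split.
  - by rewrite subrK.
  - apply: (mulfI nzc); apply: (lincomb (k := -1) h1); field; exact: nzc.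
  - by rewrite divfK.
  apply: (mulfI nzc); apply: (lincomb (k := -1) h3); field; exact: nzc.
have nzad : a - d != 0.
  apply: contra n1 => /eqP/subr0_eq ad; rewrite b0 c0 ad; apply/eqP.
  rewrite -sl2_1; have : d ^+ 2 = 1 by rewrite -e ad b0; ring.
  by move/sqr_eq1_char2->.
exists (a' - (a' - d') / (a - d) * a), ((a' - d') / (a - d)); split.
- by rewrite subrK.
- rewrite b0 mulr0; apply: (mulfI nzad); apply: (lincomb (k := 1) h2).
  by rewrite b0; ring.
- rewrite c0 mulr0; apply: (mulfI nzad); apply: (lincomb (k := -1) h3).
  by rewrite c0; ring.
by field; exact: nzad.
Qed.

Lemma commute_trans_char2 u v w : u \in G -> v \in G -> w \in G -> u != 1%g ->
  commute u v -> commute u w -> commute v w.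
Proof.
case/SL2P=> [a [b [c [d [e ->]]]]] /SL2P[a1 [b1 [c1 [d1 [e1 ->]]]]].
case/SL2P=> [a2 [b2 [c2 [d2 [e2 ->]]]]] n1.
move=> /(commute_polynomial e e1 n1)[al [be [E1 E2 E3 E4]]].
move=> /(commute_polynomial e e2 n1)[al' [be' [E1' E2' E3' E4']]].
by apply: sl2_commuteE => //; rewrite ?E1 ?E2 ?E3 ?E4 ?E1' ?E2' ?E3' ?E4'; ring.
Qed.

Lemma trace0_involution u : u \in G -> trace u = 0 -> (u ^+ 2 = 1)%g.
Proof.
case/SL2P=> [a [b [c [d [e ->]]]]]; rewrite trace_sl2 // => t.
rewrite expgS expg1; apply/eqP; rewrite -eq_invg_mul sl2V //; apply/eqP.
have d' : d = - a by apply: (lincomb (k := 1) t); ring.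
by rewrite d' !(oppr_pchar2 ch2).
Qed.

(** Writing [v = al + be * u], the traces give [be = 1], and the determinants then
    leave for [al] the values [0] and [trace u], the latter belonging to the
    inverse. *)
Lemma commute_eq_trace u v : u \in G -> v \in G -> commute u v ->
  trace v = trace u -> trace u != 0 -> v = u \/ v = u^-1%g.
Proof.
move=> Gu; have [-> | nu1] := eqVneq u 1%g.
  by rewrite trace_1 two0 eqxx.
case/SL2P: Gu nu1 => [a [b [c [d [e ->]]]]] nu1.
case/SL2P=> [a1 [b1 [c1 [d1 [e1 ->]]]]].
move=> /(commute_polynomial e e1 nu1)[al [be [E1 E2 E3 E4]]].
rewrite !trace_sl2 // => t nzt.
have be1 : be = 1.
  apply: (mulIf nzt); rewrite mul1r -[RHS]t E1 E4.
  by rewrite -[LHS]add0r -(mul0r al) -two0; ring.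
have : al * (al + (a + d)) = 0.
  apply: (lincomb (k := 1) (etrans e1 (esym e))).
  by rewrite E1 E2 E3 E4 be1; ring.
move/eqP; rewrite mulf_eq0 => /orP[/eqP al0 | /eqP alt].
  by left; congr sl2; rewrite ?E1 ?E2 ?E3 ?E4 ?al0 be1 ?add0r mul1r.
have {}alt : al = - (a + d) by apply: (lincomb (k := 1) alt); ring.
right; rewrite sl2V //; congr sl2; rewrite ?E1 ?E2 ?E3 ?E4 ?alt be1.
- by rewrite -[RHS](oppr_pchar2 ch2); ring.
- by rewrite mul1r (oppr_pchar2 ch2).
- by rewrite mul1r (oppr_pchar2 ch2).
by rewrite -[RHS](oppr_pchar2 ch2); ring.
Qed.

Lemma trace_neq0_odd u : u \in G -> u != 1%g -> odd #[u]%g -> trace u != 0.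
Proof.
move=> Gu nu1 ou; apply: contra nu1 => /eqP/(trace0_involution Gu) u2.
have o12 : (#[u]%g %| 2)%N by rewrite order_dvdn u2.
have pr2 : prime 2%N by [].
have [_ /(_ _ o12)/orP[|/eqP o2]] := elimT primeP pr2.
  by rewrite order_eq1.
by rewrite o2 in ou.
Qed.

(** Conjugation by [g] maps a central element [z] of [R] to an element commuting
    with it and of the same trace, that is to [z] or to its inverse; so [g ^+ 2]
    centralizes [z], and [g] is a power of it. *)
Lemma odd_norm_cent (r : nat) (R : {group gT}) g :
    R \subset G -> r.-group R -> odd #|R| -> g \in G -> g \in 'N(R)%g ->
  odd #[g]%g -> g \in 'C(R)%g.
Proof.
move=> sRG rR oR Gg nRg og.
have [R1 | ntR] := eqVneq ('Z(R))%g 1%g.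
  apply/centP=> y; rewrite (trivg_center_pgroup rR R1) => /set1P->.
  exact: commute1.
have [z Zz nz1] := @trivgPn _ 'Z(R)%G ntR; have [Rz cRz] := centerP _ _ Zz.
have Gz := subsetP sRG z Rz.
have Zzg : (z ^ g)%g \in 'Z(R)%g.
  by rewrite memJ_norm //; apply: (subsetP (char_norms (center_char R)) g nRg).
have [Rzg cRzg] := centerP _ _ Zzg.
have oz : odd #[z]%g by apply: dvdn_odd (order_dvdG Rz) oR.
have ntr := trace_neq0_odd Gz nz1 oz.
have := commute_eq_trace Gz (groupJ Gz Gg) (cRz _ Rzg) (traceJ Gz Gg) ntr.
move=> zg.
have cz2 : (g ^+ 2)%g \in 'C[z]%g.
  apply/cent1P/commute_sym/commgP/conjg_fixP; rewrite expgS expg1 conjgM.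
  by case: zg => e; rewrite e ?conjVg e ?invgK.
have cz : g \in 'C[z]%g.
  have -> : g = ((g ^+ 2) ^+ #[g]%g.+1./2)%g.
    rewrite -expgM mul2n (even_halfK _) /= ?og //.
    by rewrite expgS expg_order mulg1.
  exact: groupX.
apply/centP=> y Ry; apply: (commute_trans_char2 Gz Gg (subsetP sRG y Ry) nz1).
  by apply/commute_sym/cent1P.
exact: cRz.
Qed.

(** By the previous lemma Burnside's theorem applies to every prime: no prime can
    divide the order of the derived subgroup, which is contained in all the
    normal complements. *)
Lemma odd_subgroup_abelian (K : {group gT}) :
  K \subset G -> odd #|K| -> abelian K.
Proof.
move=> sKG oK; apply/derG1P/eqP; apply: contraT.
rewrite -(cardG_gt1 K^`(1)%G) => gt1; set r := pdiv #|K^`(1)%G|.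
have pr_r : prime r by apply: pdiv_prime.
have dK' : (r %| #|K^`(1)%g|)%N by apply: pdiv_dvd.
have [R sylR] := Sylow_exists r K.
have [sRK rR _] := and3P sylR.
have cNR : ('N_K(R) \subset 'C(R))%g.
  apply/subsetP=> g /setIP[Kg nRg].
  apply: (odd_norm_cent (subset_trans sRK sKG) rR) => //.
  - exact: dvdn_odd (cardSg sRK) oK.
  - exact: subsetP sKG g Kg.
  exact: dvdn_odd (order_dvdG Kg) oK.
have [L [nLK r'L _ abKL]] := Burnside_transfer sylR cNR.
have sK'L : (K^`(1) \subset L)%g by apply: der1_min; rewrite ?normal_norm.
have := pgroupP (pgroupS sK'L r'L) r pr_r dK'.
by rewrite !inE eqxx.
Qed.

(** By Burnside's theorem again, a subgroup without such an [h] would have a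
    normal 2-complement containing its elements of order 3; they would commute
    by [odd_subgroup_abelian]. *)
Lemma noncommuting_order3_fusion (H S : {group gT}) (x y : gT) :
    H \subset G -> 2.-Sylow(H) S -> x \in H -> y \in H ->
    (x ^+ 3 = 1)%g -> (y ^+ 3 = 1)%g -> ~ commute x y ->
  exists2 h, h \in 'N_H(S)%g & h \notin 'C(S)%g.
Proof.
move=> sHG sylS Hx Hy x3 y3 ncxy.
have [cNS | /subsetPn //] := boolP ('N_H(S) \subset 'C(S))%g.
have [L [nLH p'L pHL _]] := Burnside_transfer sylS cNS.
have Lo3 z : z \in H -> (z ^+ 3 = 1)%g -> z \in L.
  move=> Hz z3; have nLz : z \in 'N(L)%g by apply: (subsetP (normal_norm nLH)).
  apply: coset_idr => //; apply/eqP; rewrite -order_eq1 -dvdn1.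
  have d3 : (#[coset L z]%g %| 3)%N by rewrite order_dvdn -morphX // z3 morph1.
  have p2 : (2.-nat #[coset L z]%g)%N.
    by apply: (mem_p_elt pHL); apply: mem_quotient.
  have n3 : (2^'.-nat 3)%N by [].
  by rewrite -(eqP (pnat_coprime p2 n3)) dvdn_gcd dvdnn d3.
case: ncxy; apply: (centsP (odd_subgroup_abelian (K := L) _ _));
  rewrite ?Lo3 //.
  exact: subset_trans (normal_sub nLH) sHG.
by rewrite -coprimen2 coprime_sym; apply: pnat_coprime (isT : 2%N.-nat 2%N) p'L.
Qed.

(** Bruhat decomposition: an element with a nonzero lower left entry yields an
    antidiagonal one, which conjugates the upper unipotent matrices to the lower
    ones, and the two families generate. *)
Lemma generated_by_upper (H : {group gT}) (a b c d : F) :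
    (forall t, upper t \in H) -> a * d - b * c = 1 -> c != 0 ->
    sl2 a b c d \in H -> G \subset H.
Proof.
move=> HU e nzc Hg.
have Hw : sl2 0 (- c^-1) c 0 \in H.
  have -> : sl2 0 (- c^-1) c 0 =
      (upper (- a / c)%R * sl2 a b c d * upper (- d / c)%R)%g.
    rewrite /upper sl2M ?upper_det // sl2M ?upper_det //; last first.
      by apply: (lincomb (k := 1) e); field.
    congr sl2; [by field | | by field | by field].
    by apply: (lincomb (k := c^-1) e); field.
  by rewrite !groupM.
have dw : 0 * 0 - (- c^-1) * c = 1 by field.
have dl (t : F) : 1 * 1 - 0 * t = 1 by ring.
have HL t : sl2 1 0 t 1 \in H.
  have -> : sl2 1 0 t 1 = (upper (- t / c ^+ 2)%R ^ sl2 0 (- c^-1)%R c 0)%g.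
    apply: (mulgI (sl2 0 (- c^-1) c 0)).
    rewrite conjgE mulKVg /upper !sl2M ?upper_det //.
    by congr sl2; field.
  by rewrite groupJ.
have big (a' b' c' d' : F) : a' * d' - b' * c' = 1 -> c' != 0 ->
    sl2 a' b' c' d' \in H.
  move=> e' nzc'.
  have -> : sl2 a' b' c' d' =
      (upper ((a' - 1) / c')%R * sl2 1%R 0 c' 1%R * upper ((d' - 1) / c')%R)%g.
    rewrite /upper sl2M ?upper_det // sl2M ?upper_det //; last by field.
    congr sl2; [by field | | by field | by field].
    by apply: (mulfI nzc'); apply: (lincomb (k := -1) e'); field.
  by rewrite !groupM.
apply/subsetP=> _ /SL2P[a' [b' [c' [d' [e' ->]]]]].
have [c0 | nzc'] := eqVneq c' 0; last exact: big.
have nzd : d' != 0.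
  by apply: contra_eqN e' => /eqP ->; rewrite c0 !mulr0 subrr eq_sym oner_eq0.
rewrite -(groupMr _ (HL 1)) sl2M //; apply: big; first exact: (det2M e' (dl 1)).
by rewrite c0 mul0r add0r mulr1.
Qed.

Lemma involution_upper z : z \in G -> z != 1%g -> (z ^+ 2 = 1)%g ->
  exists g t, [/\ g \in G, t != 0 & z = (upper t ^ g)%g].
Proof.
case/SL2P=> [a [b [c [d [e ->]]]]] n1; rewrite expgS expg1 => /eqP.
rewrite -eq_invg_mul sl2V // => /eqP/esym/sl2_inj[] //.
  by rewrite -e; ring.
move=> ad _ _ _; rewrite -{}ad in e n1 *; have [c0 | nzc] := eqVneq c 0.
  have a1 : a = 1 by apply: sqr_eq1_char2; rewrite -e c0; ring.
  exists 1%g, b; rewrite group1 conjg1 /upper c0 a1; split=> //.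
  by apply: contra n1 => /eqP b0; rewrite c0 a1 b0 sl2_1 eqxx.
have dp : 0 * (1 + a) - c^-1 * c = 1.
  by rewrite mul0r sub0r mulVf // (oppr_pchar2 ch2).
(* The second row (c, 1 + a) of the base change is fixed by the involution. *)
exists (sl2 0 c^-1 c (1 + a)), c^-1.
split; [exact: sl2_in | by rewrite invr_eq0 |].
apply: (mulgI (sl2 0 c^-1 c (1 + a))).
rewrite conjgE mulKVg /upper !sl2M ?upper_det //.
congr sl2.
- by ring.
- by apply: (lincomb (k := - c^-1) two0); field.
- by apply: (lincomb (k := a * c) two0); ring.
transitivity (a + (a * a - b * c) + 2%:R * (b * c)); first by ring.
by rewrite e two0; ring.
Qed.

(** With [S] a group of upper unipotent matrices, [h] is upper triangular and
    acts on the corresponding additive group of scalars as multiplication by a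
    square other than 1, which generates the field. *)
Lemma fusion_upper (k : nat) (H S : {group gT}) (t : F) h :
    #|F| = (2 ^ k)%N -> prime k -> H \subset G -> S \subset H -> abelian S ->
    t != 0 -> upper t \in S -> h \in 'N_H(S)%g -> h \notin 'C(S)%g ->
  forall b, upper b \in H.
Proof.
move=> oF pr_k sHG sSH abS nzt St /setIP[Hh nSh] ncSh.
have nt1 : upper t != 1%g by rewrite -upper0 (inj_eq upper_inj).
have upS s : s \in S -> exists b, s = upper b.
  move=> Ss; have Gs : s \in G by apply: (subsetP sHG); apply: (subsetP sSH).
  case/SL2P: Gs Ss => [a [b [c [d [e ->]]]]] Ss.
  have [al [be [E1 E2 E3 E4]]] :=
    commute_polynomial (upper_det t) e nt1 (centsP abS _ St _ Ss).
  have c0 : c = 0 by rewrite E3 mulr0.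
  have ad : a = d by rewrite E1 E4.
  have a1 : a = 1 by apply: sqr_eq1_char2; rewrite -e c0 -ad; ring.
  by exists b; rewrite /upper -ad a1 c0.
have [t' St'] : exists t', (upper t ^ h)%g = upper t'.
  by apply: upS; rewrite memJ_norm.
have [a [b [d [e eh]]]] : exists a b d, a * d - b * 0 = 1 /\ h = sl2 a b 0 d.
  have Gh := subsetP sHG h Hh.
  case/SL2P: Gh Hh nSh ncSh St' => [a [b [c [d [e ->]]]]] _ _ _ St'.
  have : (upper t * sl2 a b c d = sl2 a b c d * upper t')%g.
    by rewrite -St' conjgE mulKVg.
  rewrite /upper !sl2M ?upper_det // => /sl2_inj[||h1 _ _ _].
  - by apply: det2M; rewrite ?upper_det.
  - by apply: det2M; rewrite ?upper_det.
  have c0 : c = 0.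
    by apply: (mulfI nzt); apply: (lincomb (k := 1) h1); ring.
  by exists a, b, d; rewrite -c0.
have hJ s : (upper s ^ h)%g = upper (d ^+ 2 * s) by rewrite eh upperJ.
pose B := [set s | upper (t * s) \in S].
have nzd : d != 0.
  by apply: contra_eqN e => /eqP ->; rewrite !mulr0 subrr eq_sym oner_eq0.
have d1 : d ^+ 2 != 1.
  apply: contra ncSh => /eqP d1; apply/centP=> s /upS[b' ->].
  by apply/commute_sym/commgP/conjg_fixP; rewrite hJ d1 mul1r.
move=> s; have : s / t \in B.
  apply: (prime_degree_generated oF pr_k _ d1 (B := B)); rewrite ?expf_neq0 //.
  - by rewrite inE mulr1.
  - move=> x y; rewrite !inE mulrDr -upperM; exact: groupM.
  - by move=> x; rewrite !inE mulrCA -hJ memJ_norm.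
by rewrite inE mulrC divfK // => /(subsetP sSH).
Qed.

(** After a conjugation the Sylow 2-subgroup [S] contains an upper unipotent
    matrix, and then [H] contains all of them by [fusion_upper]. The image of [x]
    is not triangular, for its characteristic polynomial X^2 + X + 1 has no root
    in a field of odd degree. *)
Theorem noncommuting_order3_generate (k : nat) (H : {group gT}) (x y : gT) :
    #|F| = (2 ^ k)%N -> prime k -> odd k -> H \subset G ->
    x \in H -> y \in H -> trace x = -1 -> trace y = -1 -> ~ commute x y ->
  G \subset H.
Proof.
move=> oF pr_k odd_k sHG Hx Hy tx ty ncxy.
have [Gx Gy] := (subsetP sHG x Hx, subsetP sHG y Hy).
have [S sylS] := Sylow_exists 2 H; have [sSH pS _] := and3P sylS.
have [h NHh ncSh] := noncommuting_order3_fusion sHG sylS Hx Hy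
  (traceN1_expg3 Gx tx) (traceN1_expg3 Gy ty) ncxy.
have ntZ : 'Z(S)%g != 1%g.
  apply: contraNneq ncSh => /(trivg_center_pgroup pS) ->.
  by apply/centP=> _ /set1P->; apply: commute1.
have pZ : 2.-group 'Z(S)%g by apply: pgroupS (center_sub S) pS.
have [_ dZ _] := pgroup_pdiv pZ ntZ.
have [z Zz oz] := Cauchy (isT : prime 2%N) dZ.
have [Sz cSz] := centerP _ _ Zz.
have sSG := subset_trans sSH sHG.
have Gz := subsetP sSG z Sz.
have nz1 : z != 1%g by rewrite -order_eq1 oz.
have abS : abelian S.
  apply/centsP=> u Su v Sv.
  by apply: (commute_trans_char2 Gz (subsetP sSG u Su) (subsetP sSG v Sv) nz1);
    apply: cSz.
have z2 : (z ^+ 2 = 1)%g by rewrite -oz expg_order.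
have [g [t [Gg nzt zg]]] := involution_upper Gz nz1 z2.
have GJ : (G :^ g^-1 = G)%g by rewrite conjGid // groupV.
have sHG' : (H :^ g^-1)%G \subset G by rewrite /= -GJ conjSg.
have HU : forall b, upper b \in (H :^ g^-1)%G.
  apply: (fusion_upper (S := (S :^ g^-1)%G) (h := (h ^ g^-1)%g)
            oF pr_k sHG') => //.
  - by rewrite /= conjSg.
  - by rewrite /= abelianJ.
  - exact: nzt.
  - by rewrite /= -(conjgK g (upper t)) -zg memJ_conjg.
  - by rewrite /= normJ -conjIg memJ_conjg.
  by rewrite /= centJ memJ_conjg.
have Hx' : (x ^ g^-1)%g \in (H :^ g^-1)%G by rewrite memJ_conjg.
have Gx' : (x ^ g^-1)%g \in G by rewrite groupJ ?groupV.
have : trace (x ^ g^-1)%g = -1 by rewrite traceJ ?groupV.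
case/SL2P: Gx' Hx' => [a [b [c [d [e ->]]]]] Hx'; rewrite trace_sl2 // => tr.
have nzc : c != 0.
  apply: contra (no_cube_root_odd a oF odd_k) => /eqP c0.
  have d' : d = -1 - a by apply: (lincomb (k := 1) tr); ring.
  by apply/eqP; apply: (lincomb (k := -1) e); rewrite c0 d'; ring.
by rewrite -(conjSg _ _ g^-1) /= GJ; apply: generated_by_upper HU e nzc Hx'.
Qed.

End CharTwo.

(** * The class of elements of order 3 as a rack *)

Lemma order3_class_unique : (3%:R : F) != 0 ->
  exists! C : {set coset_of Z},
    C \in classes (G / Z)%g /\ (forall x, x \in C -> #[x]%g = 3%N).
Proof.
move=> nz3; pose w := coset Z (order3_elt 1).
have Gw' := order3_elt_in (oner_neq0 F).
have Gw : w \in (G / Z)%g by apply: mem_quotient.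
have ow : #[w]%g = 3%N.
  by apply: order3_coset => //; apply: order3_elt_trace (oner_neq0 F).
exists (w ^: (G / Z))%g; split.
  split=> [|x]; first exact: mem_classes.
  by rewrite class_order3 // => /andP[_ /eqP].
move=> C [/imsetP[x Gx ->] oC]; apply/class_eqP.
by rewrite class_order3 // ?Gw ?ow //; apply/oC/class_refl.
Qed.

Section Racks.

Variables (x : coset_of Z) (Gx : x \in (G / Z)%g).
Hypothesis ox : #[x]%g = 3%N.
Let X := class_rack Gx.

Lemma lift_class (nz3 : (3%:R : F) != 0) y : y \in (x ^: (G / Z))%g ->
  exists2 u, u \in G & trace u = -1 /\ y = coset Z u.
Proof.
by rewrite class_order3 // => /andP[Gy /eqP oy]; apply: order3_lift.
Qed.

Lemma field2_abelian : #|F| = 2%N -> abelian_rack (rack_op X) X.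
Proof.
move=> oF; have ch2 : (2 \in [pchar F])%N by apply: (@card_finPcharP _ 2 1).
have nz3 : (3%:R : F) != 0.
  by rewrite (natrD _ 2 1) (pcharf0 ch2) add0r oner_eq0.
have idem (a : F) : a * a = a by rewrite -expr2 -oF expf_card.
(* Every scalar is idempotent, so that trace and determinant force b c = 1. *)
have shape u : u \in G -> trace u = -1 ->
    exists a, u = sl2 a 1 1 (-1 - a) /\ a * (-1 - a) - 1 * 1 = 1.
  case/SL2P=> [a [b [c [d [e ->]]]]]; rewrite trace_sl2 // => t.
  have d' : d = -1 - a by apply: (lincomb (k := 1) t); ring.
  have bc1 : b * c = 1.
    have : b * c = a * d - 1 by apply: (lincomb (k := -1) e); ring.
    rewrite d' mulrBr idem mulrN1 => ->.
    by apply: (lincomb (k := - a - 1) (pcharf0 ch2)); ring.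
  have b1 : b = 1 by rewrite -bc1 -{1}[b]mulr1 -bc1 mulrA idem.
  have c1 : c = 1 by rewrite -bc1 b1 mul1r.
  by exists a; rewrite -{1}d' b1 c1 in e *; rewrite d' in e *.
move=> y z /(lift_class nz3)[u Gu [tu ->]] /(lift_class nz3)[v Gv [tv ->]].
apply/conj_op_eq.
have [a [-> e]] := shape u Gu tu; have [a' [-> e']] := shape v Gv tv.
rewrite /commute -!morphM ?SL2_norm_center ?sl2_in //; congr coset.
apply: sl2_commuteE => //.
  by apply: (lincomb (k := a - a') (pcharf0 ch2)); ring.
by apply: (lincomb (k := a' - a) (pcharf0 ch2)); ring.
Qed.

Section PrimeDegree.

Variable k : nat.
Hypotheses (oF : #|F| = (2 ^ k)%N) (pr_k : prime k) (odd_k : odd k).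

Let ch2 : (2 \in [pchar F])%N. Proof. exact: card_finPcharP oF _. Qed.

Let nz3 : (3%:R : F) != 0.
Proof. by rewrite (natrD _ 2 1) (pcharf0 ch2) add0r oner_eq0. Qed.

Lemma class_rack_nonabelian : ~ abelian_rack (rack_op X) X.
Proof.
have k1 : (1 < k)%N by apply: prime_gt1.
have [t /andP[nzt nt1]] : exists t : F, (t != 0) && (t != 1).
  apply/existsP; apply: contraT => /existsPn no.
  pose A : {set F} := [set 0; 1].
  have : (#|F| <= #|A|)%N.
    rewrite -cardsT; apply/subset_leq_card/subsetP=> t _; rewrite !inE.
    by have := no t; rewrite negb_and !negbK.
  rewrite cards2 oF leqNgt => /negP[]; apply: leq_ltn_trans (_ : 2 ^ 1 < _)%N.
    by case: eqP.
  by rewrite ltn_exp2l.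
move=> abX; apply: (order3_elt_commute nzt).
  by apply: contra nt1 => /eqP/(sqr_eq1_char2 ch2)->.
by apply/conj_op_eq/abX; apply: order3_elt_class => //; apply: oner_neq0.
Qed.

(** A subrack is normalized by the group it generates, which is everything as
    soon as two of its elements fail to commute. *)
Lemma noncommuting_subrack (Y : {set coset_of Z}) y z :
  subrack X Y -> y \in Y -> z \in Y -> ~ commute y z -> Y = X :> {set _}.
Proof.
case=> sYX _ clY Yy Yz ncyz.
have [u Gu [tu yu]] := lift_class nz3 (subsetP sYX y Yy).
have [v Gv [tv zv]] := lift_class nz3 (subsetP sYX z Yz).
pose H := (G :&: coset Z @*^-1 <<Y>>)%G.
have HE w : w \in G -> (w \in H) = (coset Z w \in <<Y>>%g).
  move=> Gw; apply/setIP/idP=> [[_ /morphpreP[]] // | Yw].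
  by split=> //; apply/morphpreP; split; first exact: SL2_norm_center.
have sGH : G \subset H.
  apply: (noncommuting_order3_generate ch2 oF pr_k odd_k (subsetIl _ _)
            (x := u) (y := v)) => //.
  - by rewrite HE // -yu mem_gen.
  - by rewrite HE // -zv mem_gen.
  move=> cuv; apply: ncyz; rewrite yu zv /commute -!morphM ?SL2_norm_center //.
  by rewrite cuv.
have nY : (<<Y>> \subset 'N(Y))%g.
  rewrite gen_subG; apply/subsetP=> w Yw; rewrite -groupV inE.
  by apply/subsetP=> _ /imsetP[w' Yw' ->]; rewrite -conj_opE; apply: clY.
have sGY : (G / Z)%g \subset <<Y>>%g.
  apply/subsetP=> _ /morphimP[w _ Gw ->] /=.
  by rewrite -HE // (subsetP sGH).
apply/eqP; rewrite eqEsubset sYX /=; apply/subsetP=> w.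
rewrite -(class_eqP (subsetP sYX y Yy)) => /imsetP[g Gg ->].
by rewrite memJ_norm // (subsetP nY) // (subsetP sGY).
Qed.

Lemma proper_subrack_abelian (Y : {set coset_of Z}) :
  subrack X Y -> Y \proper X -> abelian_rack (rack_op X) Y.
Proof.
move=> sY pY y z Yy Yz /=; apply/eqP; apply: contraT => /eqP ne.
have YX : Y = X :> {set _}.
  by apply: noncommuting_subrack sY Yy Yz _ => c; apply/ne/conj_op_eq.
by rewrite YX properxx in pY.
Qed.

(** Any two elements of such a subrack commute and have lifts of trace -1, hence
    are equal or inverse to each other. *)
Lemma proper_subrack_card (Y : {set coset_of Z}) :
  subrack X Y -> Y \proper X -> (1 < #|Y|)%N -> #|Y| = 2%N.
Proof.
move=> sY pY gt1; apply/eqP; rewrite eqn_leq gt1 andbT.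
have [sYX /set0Pn[y Yy] _] := sY; have abY := proper_subrack_abelian sY pY.
have [u Gu [tu yu]] := lift_class nz3 (subsetP sYX y Yy).
suff sub2 : Y \subset [set y; y^-1%g].
  by apply: leq_trans (subset_leq_card sub2) _; rewrite cards2; case: eqP.
apply/subsetP=> z Yz; have [v Gv [tv zv]] := lift_class nz3 (subsetP sYX z Yz).
have cuv : commute u v.
  apply: (coset_commute_char2 ch2 Gu Gv); rewrite -yu -zv.
  by apply/conj_op_eq/abY.
have [||vu | vu] := commute_eq_trace ch2 Gu Gv cuv.
- by rewrite tu tv.
- by rewrite tu oppr_eq0 oner_eq0.
- by rewrite zv vu -yu !inE eqxx.
by rewrite zv vu morphV ?SL2_norm_center //= -yu !inE eqxx orbT.
Qed.

End PrimeDegree.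

(** Each case of the classification that has to be excluded contributes a proper
    non-abelian subrack: quaternions for odd [p], upper triangular matrices for
    even [k], a subfield for composite odd [k]. *)
Theorem minimal_prime_degree (p k : nat) :
    prime p -> p <> 3%N -> (0 < k)%N -> #|F| = (p ^ k)%N ->
  minimal_nonabelian X -> [/\ prime k, odd k & p = 2%N].
Proof.
move=> pr_p np3 k0 oF min.
have chp := card_finPcharP oF pr_p.
have nz3 : (3%:R : F) != 0.
  rewrite -(dvdn_pcharf chp) dvdn_prime2 //; exact/eqP.
have p2 : p = 2%N.
  apply/eqP; rewrite -(dvdn_prime2 pr_p) // (dvdn_pcharf chp).
  by apply: contraT => nz2; case: (odd_char_not_minimal nz3 ox nz2 min).
move: oF chp; rewrite {}p2 => oF chp.
have odd_k : odd k.
  apply: contraT => /(cube_root_even oF)[w ew].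
  case: (cube_root_not_minimal nz3 _ ox ew min).
  by rewrite oF (Euclid_dvdX _ _ (isT : prime 3%N)).
split=> //; apply: contraT => npr_k.
have nk1 : k != 1%N.
  apply: contraPneq min => k1 [nab _]; apply: nab; apply: field2_abelian.
  by rewrite oF k1.
have k1 : (1 < k)%N by case: k k0 nk1 {oF odd_k npr_k} => [|[]].
have [||[t Kt /andP[nzt nt1]] [z nKz]] := intermediate_subfield oF (pdiv_dvd k).
- by rewrite prime_gt1 ?pdiv_prime.
- rewrite ltn_neqAle pdiv_leq // andbT.
  by apply: contra npr_k => /eqP <-; apply: pdiv_prime.
have [K1 KN KV KD KM] := subfield_exp_closed (pdiv k) oF.
case: (subfield_not_minimal nz3 ox K1 KN KD KM nzt Kt (KV _ Kt) _ nKz min).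
by apply: contra nt1 => /eqP/(sqr_eq1_char2 chp)->.
Qed.

End Racks.

End SL2.

Theorem corollary5p18 (p k q : nat) (hp : prime p) (hp3 : p <> 3) (hk : 0 < k)
    (hq : q = (p ^ k)%N) (F : finFieldType) (hF : #|F| = q) :
  (exists! C : {set coset_of 'Z(SL 2 F)},
     C \in classes (PSL 2 F) /\ (forall x, x \in C -> #[x]%g = 3))
  /\ forall (x : coset_of 'Z(SL 2 F)) (Gx : x \in PSL 2 F), #[x]%g = 3 ->
     let X := class_rack Gx in
     [/\ q = 2 -> abelian_rack (rack_op X) X,
         minimal_nonabelian X <->
           (exists m : nat, [/\ prime m, odd m & q = (2 ^ m)%N])
       & (exists m : nat, [/\ prime m, odd m & q = (2 ^ m)%N]) ->
         forall Y : {set coset_of 'Z(SL 2 F)},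
           subrack X Y -> Y \proper X -> 1 < #|Y| -> #|Y| = 2].
Proof.
have model := SL2_modelP F.
have oF : #|F| = (p ^ k)%N by rewrite hF.
have chp := card_finPcharP oF hp.
have nz3 : (3%:R : F)%R != 0%R.
  by rewrite -(dvdn_pcharf chp) dvdn_prime2 //; apply/eqP.
split; first exact: (order3_class_unique model nz3).
move=> x Gx ox X; split.
- by move=> q2; apply: (field2_abelian model ox); rewrite hF.
- split=> [min | [m [pr_m odd_m qm]]].
    have [pr_k odd_k p2] := minimal_prime_degree model ox hp hp3 hk oF min.
    by exists k; rewrite hq p2.
  split; first exact: (class_rack_nonabelian model ox (etrans hF qm) pr_m).
  exact: (proper_subrack_abelian model ox (etrans hF qm) pr_m odd_m).
case=> m [pr_m odd_m qm].
exact: (proper_subrack_card model ox (etrans hF qm) pr_m odd_m).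
Qed.
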